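(* Suppose there is a nonrandom constant $M>1$ such that $\lim_{n\to\infty}\mathbb P(\tau_n<M|\ell_n|)=1$. Then the restriction of the shape function $\Lambda$ to $[0,1/M]$ is linear.
   Context: Let $c>0$, $q>0$, $\kappa>-1$. $F=(F(x))_{x\in\mathbb Z}$ and $B=(B(i))_{i\in\mathbb Z}$ are mutually independent families of i.i.d. random variables, $\mathbb P(B(i)=\pm1)=1/2$, and $F(x)$ has a density $\varrho$ that is even, continuous, strictly positive on $(-c,c)$, zero outside $(-c,c)$, with $\lim_{x\to c}\varrho(x)/|c-x|^{\kappa}=q$. A lazy walk satisfies $|\gamma(i+1)-\gamma(i)|\le1$; the action of a lazy walk $\gamma$ on $\{0,\dots,n\}$ is $A(B,F;\gamma)=\sum_{i=1}^nB(i)F(\gamma(i))$; $\bar A(B,F;n,k)$ is the minimal action over lazy walks from $(0,0)$ to $(n,k)$; the shape function $\Lambda:[-1,1]\to[0,\infty)$ is the deterministic function with $\bar A(B,F;n,[\alpha n])/n\to-\Lambda(\alpha)$ almost surely ($[\cdot]$ rounding towards $0$). $\bar\gamma_n$ denotes a minimizer of $A(B,F;\cdot)$ among lazy walks of length $n$ with $\gamma(0)=0$ (free endpoint). With $d(x)=2c-|F(x+1)-F(x)|$, $\ell_n=\operatorname{argmin}_{x\in\operatorname{range}(\bar\gamma_n)}d(x)$ and $\tau_n=\min\{i:\bar\gamma_n(i)\in\{\ell_n,\ell_n+1\}\}$. *)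

(* Defs.v *)
From HB Require Import structures.
From mathcomp Require Import all_boot all_order all_algebra.
From mathcomp Require Import all_classical all_reals all_analysis.

Set Implicit Arguments.
Unset Strict Implicit.
Unset Printing Implicit Defensive.

Import Order.TTheory GRing.Theory Num.Theory.
Import numFieldNormedType.Exports.

Local Open Scope classical_set_scope.
Local Open Scope ring_scope.

Section Defs.
Variable R : realType.

Definition round0 (x : R) : int :=
  if 0 <= x then Num.floor x else Num.ceil x.

Definition lazy_walk (n : nat) (gamma : nat -> int) : Prop :=
  forall i : nat, (i < n)%N -> `|gamma i.+1 - gamma i| <= 1.

Definition action (b f : int -> R) (n : nat) (gamma : nat -> int) : R :=
  \sum_(1 <= i < n.+1) b (i%:Z) * f (gamma i).

Definition min_action (b f : int -> R) (n : nat) (k : int) : R :=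
  inf [set action b f n gamma | gamma in
        [set gamma | lazy_walk n gamma /\ gamma 0%N = 0 /\ gamma n = k]].

Definition free_minimizer (b f : int -> R) (n : nat) (gamma : nat -> int) : Prop :=
  [/\ lazy_walk n gamma, gamma 0%N = 0 &
      forall g : nat -> int, lazy_walk n g -> g 0%N = 0 ->
        action b f n gamma <= action b f n g].

Definition dgap (c : R) (f : int -> R) (x : int) : R := 2 * c - `|f (x + 1) - f x|.

Definition is_ell (c : R) (f : int -> R) (n : nat) (gamma : nat -> int) (l : int) : Prop :=
  (exists2 i : nat, (i <= n)%N & gamma i = l) /\
  forall i : nat, (i <= n)%N -> dgap c f l <= dgap c f (gamma i).

Definition tau (n : nat) (gamma : nat -> int) (l : int) : nat :=
  find (fun i : nat => (gamma i == l) || (gamma i == l + 1)) (iota 0 n.+1).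

End Defs.

Definition mutually_independent d (T : measurableType d) (R : realType)
  (P : probability T R) (I : eqType) (X : I -> T -> R) : Prop :=
  forall (s : seq I) (A : I -> set R),
    uniq s -> (forall j, measurable (A j)) ->
    P (\bigcap_(j in [set` s]) (X j @^-1` A j)) =
    (\prod_(j <- s) P (X j @^-1` A j))%E.

(* Main.v *)
(* Count losses c + B(i) F(gamma(i)) >= 0 instead of actions; going to distance l at speed alpha
   then costs about l g(alpha), where g(alpha) = (c - Lambda(alpha)) / alpha.  Staying on an edge
   {x, x+1} costs d(x)/2 per step up to fluctuations, because the better of the two sites loses
   d(x)/2 + B(i) (F(x) + F(x+1))/2 at time i.

   Fix a small scale theta, let p be the probability of F > c - theta, r = p^-2 and n of order
   r / theta.  With high probability the minimizer loses O(r), hence has range O(r).  In that range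
   no three sites within a bounded distance w have |F| > c - K theta, since r p^3 tends to 0; hence
   in a time block of length w the minimizer either makes one step that costs K theta, or sits on
   a single edge, and in both cases loses at least d(ell)/2 (w - |sum of B over the block|).  So
   d(ell) = O(theta), |ell| is at least of order r, and after tau the minimizer does not do better
   than the walk staying on the edge of ell, up to a small multiple of |ell|.

   Comparing with the walk that reaches ell at a lower speed alpha < 1/M and stays there gives
   g(1/M) <= g(alpha), because tau < M |ell| allows the minimizer to wait at ell until time M |ell|.
   Waiting at ell also gives g(alpha) <= g(1/M) and Lambda(0) = c, so g is constant on (0, 1/M].
   The edge ell may be negative: Lambda is even since reflecting F preserves its law. *)
Require Import Defs.
From HB Require Import structures.
From mathcomp Require Import all_boot all_order all_algebra.
From mathcomp Require Import all_classical all_reals all_analysis.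
From mathcomp Require Import measurable_realfun.
From mathcomp Require Import zify ring lra.
Import Order.TTheory GRing.Theory Num.Theory.
Import numFieldNormedType.Exports.
Local Open Scope classical_set_scope.
Local Open Scope ring_scope.
Set Implicit Arguments.
Unset Strict Implicit.
Unset Printing Implicit Defensive.

(** * Walks and edges *)

(** The conclusion concerns deterministic numbers, so for each tolerance it suffices to exhibit one
    environment avoiding finitely many bad events whose probability bounds add up to less than 1.
    Walks are therefore compared pathwise, and probability enters through union, Markov and
    Chebyshev bounds. The obstacle is the fluctuation of the signs. Over a block of length w = v^2
    an edge costs d(ell)/2 (w ± |S|) with |S| of order v, so the upper and lower bounds differ by a
    multiple of d(ell) n / v in total. Since d(ell) n is O(r) and |ell| is at least of order r, the
    relative error is O(1/v), provided that the constants do not depend on v. Hence v is fixed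
    before theta, and theta is then taken small depending on v, so that extreme triples of range w
    become rare. Tails at multiples of theta are compared with the tail at theta by a doubling
    inequality, where the edge asymptotics of the density enter. *)

Section Deterministic.
Context {R : realType}.
Variables (c : R) (b f : int -> R).
Hypothesis hb : forall i, b i = 1 \/ b i = -1.
Hypothesis hf : forall x, `|f x| < c.

Definition loss (i : nat) (x : int) : R := c + b i%:Z * f x.

Definition walk_loss (s t : nat) (g : nat -> int) : R :=
  \sum_(s <= i < t) loss i.+1 (g i.+1).

Lemma loss_ge0 i x : 0 <= loss i x.
Proof.
rewrite /loss; have := hf x; rewrite ltr_norml => /andP[h1 h2].
by case: (hb i) => ->; lra.
Qed.

Lemma loss_le i x : loss i x <= 2 * c.
Proof.
rewrite /loss; have := hf x; rewrite ltr_norml => /andP[h1 h2].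
by case: (hb i) => ->; lra.
Qed.

Lemma c_gt0 : 0 < c.
Proof. exact: le_lt_trans (normr_ge0 _) (hf 0). Qed.

Lemma walk_loss_ge0 s t g : 0 <= walk_loss s t g.
Proof. by apply: sumr_ge0 => i _; exact: loss_ge0. Qed.

Lemma walk_loss_le s t g (e : R) :
  (forall i, (s < i <= t)%N -> loss i (g i) <= e) ->
  walk_loss s t g <= e * (t - s)%:R.
Proof.
move=> H; rewrite mulr_natr -sumr_const_nat.
by apply: ler_sum_nat => i /andP[h1 h2]; apply: H; lia.
Qed.

Lemma walk_loss_cat s t u g : (s <= t <= u)%N ->
  walk_loss s u g = walk_loss s t g + walk_loss t u g.
Proof. by move=> /andP[h1 h2]; rewrite /walk_loss (big_cat_nat h1 h2). Qed.

Lemma eq_walk_loss s t g g' : (forall i, (s < i <= t)%N -> g i = g' i) ->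
  walk_loss s t g = walk_loss s t g'.
Proof.
by move=> H; apply: eq_big_nat => i /andP[h1 h2]; rewrite H//; lia.
Qed.

Lemma action_walk_loss n g : action b f n g = walk_loss 0 n g - c * n%:R.
Proof.
rewrite /action /walk_loss big_add1 /= /loss big_split /= sumr_const_nat subn0.
by rewrite mulr_natr addrAC subrr add0r.
Qed.

(** As a function of [i] this is itself a trajectory: the walk that stays on one edge and always
    takes the cheaper end. *)
Definition edge_site (x : int) (i : nat) : int :=
  if b i%:Z * f x <= b i%:Z * f (x + 1) then x else x + 1.

Lemma edge_siteP x i : edge_site x i = x \/ edge_site x i = x + 1.
Proof. by rewrite /edge_site; case: ifP; [left|right]. Qed.

Lemma loss_edge_site x i :
  loss i (edge_site x i) = dgap c f x / 2 + b i%:Z * ((f x + f (x + 1)) / 2).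
Proof.
rewrite /loss /edge_site /dgap; case: (hb i) => ->; rewrite ?mulN1r ?mul1r ?lerN2.
  by case: (lerP (f x) (f (x + 1))) => h; lra.
by case: (ltrgtP (f x) (f (x + 1))) => h /=; lra.
Qed.

(** Because |a + b| + |a - b| = 2 max(|a|, |b|), and both values stay below [c]. Thus the
    fluctuating term of [loss_edge_site] never exceeds the mean one. *)
Lemma edge_mean_le x : `|(f x + f (x + 1)) / 2| <= dgap c f x / 2.
Proof.
rewrite /dgap; have := hf x; have := hf (x + 1); rewrite !ltr_norml ler_norml.
by case: (lerP (f x) (f (x + 1))) => h /andP[? ?] /andP[? ?]; lra.
Qed.

Lemma loss_edge_site_le x i : loss i (edge_site x i) <= dgap c f x.
Proof.
rewrite loss_edge_site; have := edge_mean_le x; rewrite ler_norml => /andP[? ?].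
by case: (hb i) => ->; lra.
Qed.

Lemma dgap_ge0 x : 0 <= dgap c f x.
Proof. exact: le_trans (loss_ge0 0 _) (loss_edge_site_le x 0). Qed.

Definition bsum (s t : nat) : R := \sum_(s <= i < t) b i.+1%:Z.

Lemma edge_loss x s t : (s <= t)%N ->
  walk_loss s t (edge_site x) <= dgap c f x / 2 * ((t - s)%:R + `|bsum s t|).
Proof.
move=> st; rewrite /walk_loss.
under eq_bigr do rewrite loss_edge_site.
rewrite big_split /= sumr_const_nat -mulr_suml -/(bsum s t) mulrDr mulr_natr lerD2l.
apply: le_trans (ler_norm _) _; rewrite normrM mulrC.
by apply: ler_wpM2r => //; exact: edge_mean_le.
Qed.

Lemma edge_loss_le x s t : walk_loss s t (edge_site x) <= dgap c f x * (t - s)%:R.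
Proof. by apply: walk_loss_le => i _; exact: loss_edge_site_le. Qed.

Lemma bsum_le s t : `|bsum s t| <= (t - s)%:R.
Proof.
rewrite /bsum; apply: le_trans (ler_norm_sum _ _ _) _.
rewrite -(sumr_const_nat t s 1); apply: ler_sum => i _.
by case: (hb i.+1) => ->; rewrite ?normrN normr1.
Qed.

(** In the second case the signs are constant and the lower bound of [block_loss_ge] is zero.
    Otherwise the change is located at two consecutive times, so that the sites occupied then are at
    distance at most 1. *)
Lemma bsum_cases s t : (s <= t)%N ->
  (exists k, [/\ (s < k)%N, (k < t)%N & b k%:Z != b k.+1%:Z]) \/
  `|bsum s t| = (t - s)%:R.
Proof.
move=> st.
have [H|H] := pselect (exists k, [/\ (s < k)%N, (k < t)%N & b k%:Z != b k.+1%:Z]);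
  [by left | right].
have E k : (s < k)%N -> (k <= t)%N -> b k%:Z = b s.+1%:Z.
  elim: k => // k IH sk kt.
  have [->//|ks] := eqVneq k s.
  rewrite -IH; [|lia|lia]; apply/eqP; rewrite eq_sym; apply/negPn/negP => nk.
  by apply: H; exists k; split => //; lia.
rewrite /bsum (eq_big_nat _ _ (F2 := fun=> b s.+1%:Z)); last first.
  by move=> i /andP[? ?]; rewrite E//; lia.
rewrite sumr_const_nat normrMn.
by case: (hb s.+1) => ->; rewrite ?normrN normr1.
Qed.

Lemma walk_loss_term s t g i : (s < i <= t)%N -> loss i (g i) <= walk_loss s t g.
Proof.
case: i => // i /andP[si it].
rewrite (@walk_loss_cat s i t); last by rewrite -ltnS si (ltnW it).
rewrite {2}/walk_loss (big_ltn it) addrCA lerDl addr_ge0 ?walk_loss_ge0//.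
Qed.

(** Either one step loses [K], which is already at least [(t - s) d / 2]; or every visited site is
    extreme, with [f] of sign opposite to [b]. A sign change then produces two adjacent extreme
    sites of opposite signs, and the exclusion of extreme triples confines the walk to them. *)
Lemma block_loss_ge n g s t (d K : R) :
  lazy_walk n g -> (s <= t <= n)%N -> 0 <= d ->
  (forall i, (i <= n)%N -> d <= dgap c f (g i)) ->
  K <= c -> (t - s)%:R * d / 2 <= K ->
  (forall i j k, (s < i <= t)%N -> (s < j <= t)%N -> (s < k <= t)%N ->
    c - K < `|f (g i)| -> c - K < `|f (g j)| -> c - K < `|f (g k)| ->
    [\/ g i = g j, g i = g k | g j = g k]) ->
  d / 2 * ((t - s)%:R - `|bsum s t|) <= walk_loss s t g.
Proof.
move=> lz /andP[st tn] d0 dg Kc wK notri.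
have [[k [sk kt bk]]|->] := bsum_cases st; last first.
  by rewrite subrr mulr0 walk_loss_ge0.
have [[i [sit iK]]|NK] :=
    pselect (exists i, (s < i <= t)%N /\ K <= loss i (g i)).
  apply: le_trans (le_trans iK (walk_loss_term g sit)).
  apply: le_trans wK; rewrite mulrBr.
  have : 0 <= d / 2 * `|bsum s t| by rewrite mulr_ge0// divr_ge0.
  by lra.
have {}NK i : (s < i <= t)%N -> loss i (g i) < K.
  by move=> h; rewrite ltNge; apply/negP => h2; apply: NK; exists i.
have high i : (s < i <= t)%N -> c - K < `|f (g i)|.
  move/NK; rewrite /loss; case: (hb i) => -> h;
  by case: (ger0P (f (g i))) => ?; lra.
have sg i : (s < i <= t)%N -> b i%:Z = 1 -> f (g i) < 0.
  by move/NK; rewrite /loss => + h1; rewrite h1; lra.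
have sg' i : (s < i <= t)%N -> b i%:Z = -1 -> 0 < f (g i).
  by move/NK; rewrite /loss => + h1; rewrite h1; lra.
have skt : (s < k <= t)%N by lia.
have skt1 : (s < k.+1 <= t)%N by lia.
have [p [m [pI mI bp bm pm]]] : exists p m, [/\ (s < p <= t)%N, (s < m <= t)%N,
    b p%:Z = 1, b m%:Z = -1 & `|g p - g m| <= 1].
  have lk : `|g k.+1 - g k| <= 1 by apply: lz; lia.
  case: (hb k) (hb k.+1) bk => hk [] hk1; rewrite hk hk1 ?eqxx// => _.
    by exists k, k.+1; split => //; rewrite distrC.
  by exists k.+1, k; split.
(* Each visited site is one of the two, and the sign of [b] decides which, since [f] has different
   signs there. *)
have site i : (s < i <= t)%N -> g i = if b i%:Z == 1 then g p else g m.
  move=> iI; have := notri _ _ _ iI pI mI (high _ iI) (high _ pI) (high _ mI).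
  have := sg _ pI bp; have := sg' _ mI bm.
  case: eqP => hi fm fp [] //.
  - by move=> e; exfalso; have := sg _ iI hi; rewrite e; lra.
  - by move=> e; exfalso; move: fm; rewrite -e; lra.
  - have {}hi : b i%:Z = -1 by case: (hb i).
    by move=> e; exfalso; have := sg' _ iI hi; rewrite e; lra.
  - by move=> e; exfalso; move: fm; rewrite -e; lra.
set u := c + f (g p); set v := c - f (g m).
have u0 : 0 <= u by have := loss_ge0 p (g p); rewrite /loss bp mul1r.
have v0 : 0 <= v by have := loss_ge0 m (g m); rewrite /loss bm mulN1r.
(* [u + v] is the gap of the edge. A gap is indexed by the left end, and whichever of the two sites
   that is, it is visited, so its gap is at least [d]. *)
have duv : d <= u + v.
  have npm : g p <> g m.
    by move=> e; have := sg _ pI bp; have := sg' _ mI bm; rewrite e; lra.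
  have fpm : `|f (g p) - f (g m)| = f (g m) - f (g p).
    by rewrite ler0_norm ?opprB//; have := sg _ pI bp; have := sg' _ mI bm; lra.
  have [e|e] : g p = g m + 1 \/ g m = g p + 1 by lia.
    have := dg m; rewrite /dgap -e fpm /u /v => h.
    by have := h ltac:(lia); lra.
  have := dg p; rewrite /dgap -e distrC fpm /u /v => h.
  by have := h ltac:(lia); lra.
have -> : walk_loss s t g =
    \sum_(s <= i < t) ((u + v) / 2 + b i.+1%:Z * ((u - v) / 2)).
  apply: eq_big_nat => i iI; have iI' : (s < i.+1 <= t)%N by lia.
  rewrite /loss (site _ iI'); case: (hb i.+1) => ->.
    by rewrite eqxx /u /v; lra.
  have -> : (-1 == 1 :> R) = false by apply/eqP; lra.
  by rewrite /u /v; lra.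
rewrite big_split /= sumr_const_nat -mulr_suml -/(bsum s t).
have := bsum_le s t; have : `|u - v| <= u + v by case: (lerP u v); lra.
rewrite -(mulr_natr ((u + v) / 2)).
set S := bsum s t; set W := (t - s)%:R => uv SW.
have : - ((u + v) / 2 * `|S|) <= S * ((u - v) / 2).
  have : `|S * ((u - v) / 2)| <= (u + v) / 2 * `|S|.
    rewrite normrM mulrC ler_wpM2r// normrM (ger0_norm (x := 2^-1))//.
    by rewrite ler_wpM2r.
  by rewrite ler_norml => /andP[].
have : d * (W - `|S|) <= (u + v) * (W - `|S|) by rewrite ler_wpM2r// subr_ge0.
by lra.
Qed.

(** Sites visited within one block are within [w] of each other, so extreme triples have to be
    excluded only locally; this keeps their number linear in the range of the walk. *)
Lemma blocks_loss_ge n g w j0 J (d K : R) :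
  lazy_walk n g -> (j0 <= J)%N -> (J * w <= n)%N -> 0 <= d ->
  (forall i, (i <= n)%N -> d <= dgap c f (g i)) ->
  K <= c -> w%:R * d / 2 <= K ->
  (forall i j k, (i <= n)%N -> (j <= n)%N -> (k <= n)%N ->
    `|g j - g i| <= w%:Z -> `|g k - g i| <= w%:Z ->
    c - K < `|f (g i)| -> c - K < `|f (g j)| -> c - K < `|f (g k)| ->
    [\/ g i = g j, g i = g k | g j = g k]) ->
  \sum_(j0 <= j < J) d / 2 * (w%:R - `|bsum (j * w) (j.+1 * w)|)
    <= walk_loss (j0 * w) (J * w) g.
Proof.
move=> lz j0J Jn d0 dg Kc wK notri.
have step i j : (i <= j)%N -> (j <= n)%N -> `|g j - g i| <= j%:Z - i%:Z.
  elim: j => [|j IH] ij jn; first by have -> : i = 0%N by [lia]; rewrite !subrr normr0.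
  have [->|ne] := eqVneq i j.+1; first by rewrite !subrr normr0.
  have := IH ltac:(lia) ltac:(lia); have := lz j jn; lia.
elim: J j0J Jn => [|J IH] j0J Jn.
  by rewrite big_geq// walk_loss_ge0.
have [->|ne] := eqVneq j0 J.+1; first by rewrite big_geq// walk_loss_ge0.
have j0J' : (j0 <= J)%N by lia.
rewrite big_nat_recr//= (@walk_loss_cat _ (J * w)); last by nia.
apply: lerD; first by apply: IH => //; nia.
have E : (J.+1 * w - J * w = w)%N by nia.
rewrite -{1}E; apply: (block_loss_ge lz _ d0 dg Kc); rewrite ?E//; first by nia.
move=> i j k iI jI kI; apply: notri; try nia.
  by have [ij|ij] := leqP i j; have := step _ _ ltac:(exact: ij) ltac:(nia);
    [|have := step _ _ (ltnW ij) ltac:(nia)]; nia.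
have [ij|ij] := leqP i k; first by have := step _ _ ij ltac:(nia); nia.
by have := step _ _ (ltnW ij) ltac:(nia); nia.
Qed.

Lemma blocks_edge_loss x w j0 J : (j0 <= J)%N ->
  walk_loss (j0 * w) (J * w) (edge_site x) <=
  \sum_(j0 <= j < J) dgap c f x / 2 * (w%:R + `|bsum (j * w) (j.+1 * w)|).
Proof.
elim: J => [|J IH] j0J; first by rewrite /walk_loss !big_geq//; nia.
have [->|ne] := eqVneq j0 J.+1; first by rewrite /walk_loss !big_geq.
rewrite big_nat_recr//=; last by lia.
rewrite (@walk_loss_cat _ (J * w)); last by nia.
apply: lerD; first by apply: IH; lia.
have E : (J.+1 * w - J * w = w)%N by nia.
by have := @edge_loss x (J * w) (J.+1 * w) ltac:(nia); rewrite E.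
Qed.

(** A walk reaching [rho] in direction [e] makes a first visit to each intermediate site, and a
    visit to a site with |f| <= c/2 loses at least c/2 whatever the sign of [b]. *)
Lemma range_loss_ge n g (e : int) (rho : nat) i : e = 1 \/ e = -1 ->
  lazy_walk n g -> g 0%N = 0 -> (i <= n)%N -> rho%:Z <= e * g i ->
  c / 2 * \sum_(0 <= x < rho) (`|f (e * x.+1%:Z)| <= c / 2)%R%:R <= walk_loss 0 n g.
Proof.
move=> he lz g0 iN rg.
have c0 := c_gt0.
(* [m] is the running maximum of [e * g]; laziness makes it grow by at most one per step, so no site
   is skipped. *)
have H t : (t <= n)%N -> exists m : nat, (forall i, (i <= t)%N -> e * g i <= m%:Z) /\
    c / 2 * \sum_(0 <= x < m) (`|f (e * x.+1%:Z)| <= c / 2)%R%:R <= walk_loss 0 t g.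
  elim: t => [|t IH] tn.
    exists 0%N; split; last by rewrite big_geq// mulr0 walk_loss_ge0.
    by move=> j; rewrite leqn0 => /eqP ->; rewrite g0 mulr0.
  have [m [mb ml]] := IH (ltnW tn).
  have wl : walk_loss 0 t.+1 g = walk_loss 0 t g + loss t.+1 (g t.+1).
    by rewrite /walk_loss big_nat_recr.
  have [le|gt] := lerP (e * g t.+1) m%:Z.
    exists m; split; last first.
      by rewrite wl; apply: le_trans ml _; rewrite lerDl loss_ge0.
    move=> j; rewrite leq_eqVlt => /orP[/eqP ->//|]; rewrite ltnS; exact: mb.
  have gm : g t.+1 = e * m.+1%:Z.
    have := mb t (leqnn _); have := lz t tn; case: he gt => ->; lia.
  exists m.+1; split.
    move=> j; rewrite leq_eqVlt => /orP[/eqP ->|].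
      by rewrite gm; case: he => ->; lia.
    by rewrite ltnS => /mb; lia.
  rewrite big_nat_recr//= mulrDr wl; apply: lerD => //.
  rewrite -gm; case: (lerP `|f (g t.+1)| (c / 2)) => h; last by rewrite mulr0 loss_ge0.
  rewrite mulr1 /loss; move: h; rewrite ler_norml => /andP[? ?].
  by case: (hb t.+1) => ->; lra.
have [m [mb ml]] := H n (leqnn _); apply: le_trans ml.
rewrite ler_pM2l ?divr_gt0//.
have rm : (rho <= m)%N by have := mb i iN; lia.
rewrite (big_cat_nat (leq0n rho) rm)/= lerDl.
by apply: sumr_ge0 => j _; rewrite ler0n.
Qed.

Definition glue (g : nat -> int) (t : nat) (h : nat -> int) : nat -> int :=
  fun i => if (i <= t)%N then g i else h i.

Lemma lazy_glue n g t h : lazy_walk t g -> (forall i, (t < i < n)%N -> `|h i.+1 - h i| <= 1) ->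
  ((t < n)%N -> `|h t.+1 - g t| <= 1) -> lazy_walk n (glue g t h).
Proof.
move=> lg lh lt i iN; rewrite /glue.
case: (ltngtP i t) => it.
- by apply: lg.
- by apply: lh; rewrite it.
- by rewrite it; apply: lt; rewrite -it.
Qed.

Lemma glue_loss g t h n : (t <= n)%N ->
  walk_loss 0 n (glue g t h) = walk_loss 0 t g + walk_loss t n h.
Proof.
move=> tn; rewrite (@walk_loss_cat 0 t n)//; congr (_ + _); apply: eq_walk_loss => i;
by rewrite /glue => /andP[h1 h2]; rewrite ?h2// leqNgt h1.
Qed.

Lemma lazy_edge_site x i j : `|edge_site x i - edge_site x j| <= 1.
Proof. by case: (edge_siteP x i) => ->; case: (edge_siteP x j) => ->; lia. Qed.

Lemma edge_site_near x y i : y = x \/ y = x + 1 -> `|edge_site x i - y| <= 1.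
Proof. by case: (edge_siteP x i) => ->; case=> ->; lia. Qed.

(** The infimum of [walk_loss 0 m] over walks from 0 to [k], since loss and action differ by
    [c * m]. Along direction alpha it grows like m (c - Lambda(alpha)). *)
Definition cost (m : nat) (k : int) : R := c * m%:R + min_action b f m k.

Lemma cost_le m g : lazy_walk m g -> g 0%N = 0 -> cost m (g m) <= walk_loss 0 m g.
Proof.
move=> lz g0; suff : min_action b f m (g m) <= action b f m g.
  by rewrite action_walk_loss /cost; lra.
apply: ge_inf; last by exists g.
exists (- (c * m%:R)) => _ [h _ <-].
by rewrite action_walk_loss lerDr walk_loss_ge0.
Qed.

(** The infimum is approached within 1 instead of being attained; this additive 1 is negligible
    against |ell|. For nonemptiness, walk straight to [k] and wait there. *)
Lemma cost_ex m k : (`|k| <= m)%N ->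
  exists g, [/\ lazy_walk m g, g 0%N = 0, g m = k & walk_loss 0 m g <= cost m k + 1].
Proof.
move=> km.
set A := [set action b f m g | g in
   [set g | lazy_walk m g /\ g 0%N = 0 /\ g m = k]].
have A0 : A !=set0.
  pose g := fun i : nat => if 0 <= k then (minn i `|k|)%:Z else - (minn i `|k|)%:Z.
  exists (action b f m g), g => //; rewrite /g; split => [i im|]; first by case: ifP; lia.
  by case: ifP; lia.
have Alb : has_lbound A.
  exists (- (c * m%:R)) => _ [h _ <-].
  by rewrite action_walk_loss lerDr walk_loss_ge0.
have [_ [g [lz [g0 gm]] <-] h] := @inf_adherent _ A 1 ltr01 (conj A0 Alb).
exists g; split => //; move: h; rewrite action_walk_loss -/(min_action b f m k) /cost.
by lra.
Qed.

End Deterministic.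

(** [find] would return its default [n + 1] if the edge were missed, but [l] lies in the range of
    the walk. *)
Lemma tauP (R : realType) (c : R) (f : int -> R) n g l : is_ell c f n g l ->
  (tau n g l <= n)%N /\
  (g (tau n g l) = l \/ g (tau n g l) = l + 1).
Proof.
case=> [[i iN gi] _].
have H : has (fun i : nat => (g i == l) || (g i == l + 1)) (iota 0 n.+1).
  by apply/hasP; exists i; [rewrite mem_iota; lia | rewrite gi eqxx].
have tn : (tau n g l < n.+1)%N by move: H; rewrite has_find size_iota.
split => //; have := nth_find 0%N H; rewrite -/(tau n g l) nth_iota// add0n.
by case/orP => /eqP ->; [left|right].
Qed.

(** * Competing walks that wait on the edge of ell *)

Section Comparison.
Context {R : realType}.
Variables (c : R) (b f : int -> R).
Hypothesis hb : forall i, b i = 1 \/ b i = -1.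
Hypothesis hf : forall x, `|f x| < c.

Lemma lazy_walkS n m g : (m <= n)%N -> lazy_walk n g -> lazy_walk m g.
Proof. by move=> mn lz i im; apply: lz; exact: leq_trans im mn. Qed.

(** Waiting on the edge costs at most the gap per step. The last step is forced onto [l], because
    [cost] prescribes the endpoint while the edge walk may be at either end; this is the extra
    [2 * c]. *)
Lemma cost_edge_extend l m1 m0 g : lazy_walk m1 g -> g 0%N = 0 ->
  g m1 = l \/ g m1 = l + 1 -> (m1 < m0)%N ->
  cost c b f m0 l <= walk_loss c b f 0 m1 g + dgap c f l * m0%:R + 2 * c.
Proof.
move=> lz g0 gm m10.
pose h := fun i => if i == m0 then l else edge_site b f l i.
pose p := glue g m1 h.
have lzp : lazy_walk m0 p.
  apply: lazy_glue => // [i im|_]; rewrite /h.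
    rewrite (negbTE (_ : i != m0)); last by lia.
    case: eqP => _; last exact: lazy_edge_site.
    by rewrite distrC; apply: edge_site_near; left.
  case: eqP => _; last exact: edge_site_near.
  by case: gm => ->; lia.
have pm : p m0 = l by rewrite /p /glue leqNgt m10 /= /h eqxx.
have := cost_le hb hf lzp; rewrite pm => /(_ _)/le_trans; apply.
  by rewrite /p /glue.
rewrite /p glue_loss; last exact: ltnW.
rewrite -addrA lerD2l.
case: m0 m10 @h @p lzp pm => // m0 m10 h p lzp pm.
rewrite /walk_loss big_nat_recr//=.
apply: lerD; last exact: loss_le.
apply: le_trans (_ : walk_loss c b f m1 m0 (edge_site b f l) <= _).
  rewrite -/(walk_loss c b f m1 m0 h) le_eqVlt; apply/orP; left; apply/eqP.
  apply: eq_walk_loss => i im; rewrite /h.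
  by rewrite (negbTE (_ : i != m0.+1)); last lia.
apply: le_trans (edge_loss_le hb hf _ _ _) _.
rewrite ler_wpM2l ?(dgap_ge0 hb hf)// ler_nat; lia.
Qed.

Lemma cost_line_le (k : int) (m : nat) : (`|k| <= m)%N ->
  cost c b f m k <= 2 * c * m%:R.
Proof.
move=> km.
pose g := fun i : nat => if 0 <= k then (minn i `|k|)%:Z else - (minn i `|k|)%:Z.
have lz : lazy_walk m g by move=> i im; rewrite /g; case: ifP; lia.
have gm : g m = k by rewrite /g; case: ifP; lia.
have := cost_le hb hf lz; rewrite gm => /(_ _)/le_trans; apply.
  by rewrite /g min0n; case: ifP.
by rewrite -{2}(subn0 m); apply: walk_loss_le => i _; exact: loss_le.
Qed.

(** Go to [l], wait on its edge, come straight back. With a small gap and |l| much smaller than [m]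
    this is what gives Lambda(0) = c. *)
Lemma cost_zero_le l m : (2 * `|l| < m)%N ->
  cost c b f m 0 <= 4 * c * `|l|%:R + 2 * c + 1 + dgap c f l * m%:R.
Proof.
move=> lm.
have [g [lz g0 gl Lg]] := cost_ex hb hf (leqnn `|l|).
have cl := cost_line_le (leqnn `|l|).
(* The return takes [|l| + 1] steps after time [t]: one to get from either end of the edge to [l],
   then [|l|] straight ones. *)
pose t := (m - `|l|).-1.
pose p := glue g `|l| (edge_site b f l).
pose q := glue p t (fun i => if 0 <= l then m%:Z - i%:Z else i%:Z - m%:Z).
have lzp : lazy_walk t p.
  apply: lazy_glue => // [i _|_]; first exact: lazy_edge_site.
  by apply: edge_site_near; left.
have pt : `|p t - l| <= 1.
  rewrite /p /glue; case: leqP => tl; last by apply: edge_site_near; left.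
  have -> : t = `|l|%N by rewrite /t in tl *; lia.
  by rewrite gl subrr.
have lzq : lazy_walk m q.
  apply: lazy_glue => // [i _|tm]; first by case: ifP; lia.
  have : l = if 0 <= l then m%:Z - t.+1%:Z else t.+1%:Z - m%:Z.
    by rewrite /t; case: ifP; lia.
  by rewrite distrC => <-.
have q0 : q 0%N = 0 by rewrite /q /p /glue.
have qm : q m = 0.
  rewrite /q /glue leqNgt (_ : (t < m)%N)//=; last by rewrite /t; lia.
  by rewrite subrr; case: ifP.
have := cost_le hb hf lzq q0; rewrite qm => /le_trans; apply.
have tl : (`|l| <= t)%N by rewrite /t; lia.
rewrite /q glue_loss; last by rewrite /t; lia.
rewrite /p glue_loss//.
have e1 := edge_loss_le hb hf l `|l| t.
have e2 : walk_loss c b f t m (fun i => if 0 <= l then m%:Z - i%:Z else i%:Z - m%:Z)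
    <= 2 * c * (m - t)%:R.
  by apply: walk_loss_le => i _; exact: loss_le.
have e3 : dgap c f l * (t - `|l|)%:R <= dgap c f l * m%:R - 0.
  by rewrite subr0 ler_wpM2l ?(dgap_ge0 hb hf)// ler_nat /t; lia.
have mt : (m - t = `|l|.+1)%N by rewrite /t; lia.
move: e2; rewrite mt -natr1 => e2; lra.
Qed.

Section Minimizer.
Variables (n : nat) (g : nat -> int) (l : int).
Hypothesis gmin : free_minimizer b f n g.
Hypothesis hl : is_ell c f n g l.

Let lz : lazy_walk n g. Proof. by case: gmin. Qed.
Let g0 : g 0%N = 0. Proof. by case: gmin. Qed.

Lemma minimizer_loss_min h : lazy_walk n h -> h 0%N = 0 ->
  walk_loss c b f 0 n g <= walk_loss c b f 0 n h.
Proof.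
case: gmin => _ _ gm lh h0; have := gm h lh h0.
by rewrite !(action_walk_loss c); lra.
Qed.

Lemma minimizer_loss_le (x : nat) : (x <= n)%N ->
  walk_loss c b f 0 n g <= 2 * c * x%:R + dgap c f x%:Z * n%:R.
Proof.
move=> xn.
pose p := glue (fun i => i%:Z) x (edge_site b f x%:Z).
have lzp : lazy_walk n p.
  apply: lazy_glue => [i im|i _|_]; first by lia.
    exact: lazy_edge_site.
  by apply: edge_site_near; left.
apply: le_trans (minimizer_loss_min lzp _) _; first by rewrite /p /glue.
rewrite /p glue_loss//; apply: lerD.
  by rewrite -{2}(subn0 x); apply: walk_loss_le => i _; exact: loss_le.
apply: le_trans (edge_loss_le hb hf _ _ _) _.
by rewrite ler_wpM2l ?(dgap_ge0 hb hf)// ler_nat; lia.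
Qed.

(** The competitor reaches [l] almost optimally at time [m0] and then keeps to its edge. Up to the
    block boundary [j0 * w] the crude rate [dgap] is enough; beyond it the sharp rate is kept so as
    to cancel against [blocks_loss_ge]. *)
Lemma minimizer_loss_le_cost w J m0 j0 : n = (J * w)%N ->
  (`|l| <= m0)%N -> (m0 <= j0 * w)%N -> (j0 <= J)%N ->
  walk_loss c b f 0 n g <= cost c b f m0 l + 1 + dgap c f l * (j0 * w - m0)%:R
   + \sum_(j0 <= j < J) dgap c f l / 2 * (w%:R + `|bsum b (j * w) (j.+1 * w)|).
Proof.
move=> nE lm m0j j0J.
have [p [lzp p0 pm Lp]] := cost_ex hb hf lm.
pose q := glue p m0 (edge_site b f l).
have lzq : lazy_walk n q.
  apply: lazy_glue => // [i _|_]; first exact: lazy_edge_site.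
  by apply: edge_site_near; left.
apply: le_trans (minimizer_loss_min lzq _) _; first by rewrite /q /glue.
have m0n : (m0 <= n)%N by nia.
rewrite /q glue_loss// -[X in _ <= X]addrA; apply: lerD => //.
rewrite (@walk_loss_cat _ c b f m0 (j0 * w)) ?nE; last by nia.
by apply: lerD; [exact: edge_loss_le | exact: blocks_edge_loss].
Qed.

Lemma minimizer_range (rho : nat) (e : int) : e = 1 \/ e = -1 ->
  walk_loss c b f 0 n g <
    c / 2 * \sum_(0 <= x < rho) (`|f (e * x.+1%:Z)| <= c / 2)%R%:R ->
  forall i, (i <= n)%N -> e * g i < rho%:Z.
Proof.
move=> he H i iN; rewrite ltNge; apply/negP => h.
have := range_loss_ge hb hf he lz g0 iN h.
by rewrite leNgt H.
Qed.

End Minimizer.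

(** On each block 2 |S| <= S^2 / v + v, where [v] is the typical size of S. The sum is at most (200
    + 1) / 2 times [J v], rounded up to 101. *)
Lemma sum_bsum_le v J : (0 < v)%N ->
  \sum_(0 <= j < J) bsum b (j * (v * v)) (j.+1 * (v * v)) ^+ 2
     <= 200 * (J * (v * v))%:R :> R ->
  \sum_(0 <= j < J) `|bsum b (j * (v * v)) (j.+1 * (v * v))| <= 101 * (J * v)%:R.
Proof.
move=> v0 H.
have vR : 0 < v%:R :> R by rewrite ltr0n.
have : \sum_(0 <= j < J) (2 * `|bsum b (j * (v * v)) (j.+1 * (v * v))|) <=
   \sum_(0 <= j < J) (bsum b (j * (v * v)) (j.+1 * (v * v)) ^+ 2 / v%:R + v%:R).
  apply: ler_sum_nat => j _; set S := bsum _ _ _.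
  have -> : S ^+ 2 / v%:R + v%:R = (S ^+ 2 + v%:R * v%:R) / v%:R.
    by field; rewrite gt_eqF.
  rewrite ler_pdivlMr// -[S ^+ 2]real_normK ?num_real//.
  by have := sqr_ge0 (`|S| - v%:R); nra.
rewrite big_split /= sumr_const_nat subn0 -mulr_suml -mulr_sumr -(mulr_natr v%:R J) => h.
have : (\sum_(0 <= j < J) bsum b (j * (v * v)) (j.+1 * (v * v)) ^+ 2) / v%:R
   <= 200 * (J * v)%:R.
  by rewrite ler_pdivrMr// -mulrA -natrM -mulnA.
rewrite natrM; move: h.
set X := (\sum_(_ <= _ < _) _) / _; set Y := \sum_(_ <= _ < _) _ => h1 h2.
have {}h1 : 2 * Y <= X + J%:R * v%:R by rewrite [J%:R * _]mulrC.
have {}h2 : X <= 200 * (J%:R * v%:R) by [].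
by have : 0 <= J%:R * v%:R :> R by [rewrite mulr_ge0]; lra.
Qed.

End Comparison.

(** * The minimizer in a good environment *)

Section Core.
Context {R : realType}.
Variables (c : R) (b f : int -> R).
Hypothesis hb : forall i, b i = 1 \/ b i = -1.
Hypothesis hf : forall x, `|f x| < c.

(** [Q] bounds the loss of the minimizer, [rho] its range, [E] the gap of [l]; [K] is the level of
    extremeness and [D] the radius free of edges with two [E]-extreme ends. For the last claim, the
    minimizer is cut at [tau] and made to wait until [m1], while its total loss is compared with
    that of the walk reaching [l] at [m0]. After the first block boundary the two losses agree up to
    the fluctuations and cancel. *)
Lemma minimizer_comparison (n v J rho : nat) (g : nat -> int) (l : int) (Q E K D : R) :
  free_minimizer b f n g -> is_ell c f n g l ->
  n = (J * (v * v))%N -> (202 <= v)%N ->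
  \sum_(0 <= j < J) bsum b (j * (v * v)) (j.+1 * (v * v)) ^+ 2 <= 200 * n%:R :> R ->
  (exists2 x : nat, (x <= n)%N & 2 * c * x%:R + dgap c f x%:Z * n%:R <= Q) ->
  (forall e : int, e = 1 \/ e = -1 ->
    Q < c / 2 * \sum_(0 <= x < rho) (`|f (e * x.+1%:Z)| <= c / 2)%R%:R) ->
  0 < E -> 4 * Q < E * n%:R -> (v * v)%:R * E / 2 <= K -> E <= K -> K <= c ->
  (forall x y z : int, `|x| <= rho%:Z -> `|y - x| <= (v * v)%:Z -> `|z - x| <= (v * v)%:Z ->
    c - K < `|f x| -> c - K < `|f y| -> c - K < `|f z| -> [\/ x = y, x = z | y = z]) ->
  (forall x : int, `|x|%N%:R <= D -> ~ (c - E < `|f x| /\ c - E < `|f (x + 1)|)) ->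
  [/\ dgap c f l < E, D < `|l|%N%:R, (`|l| <= rho)%N &
    forall m0 m1, (tau n g l < m1 <= m0)%N -> (`|l| <= m0)%N -> (m0 + v * v <= n)%N ->
      cost c b f m1 l <= cost c b f m0 l + 1 + 2 * c +
        dgap c f l * (m1%:R + (v * v)%:R + 101 * (J * v)%:R)].
Proof.
move=> gmin hl nE v202 hS [x0 x0n hx0] low E0 QE wEK EK Kc notri near.
have [lz g0 _] := gmin.
have [[i0 i0n gi0] lmin] := hl.
have LQ : walk_loss c b f 0 n g <= Q.
  exact: le_trans (minimizer_loss_le hb hf gmin x0n) hx0.
have v0 : (0 < v)%N by apply: leq_trans v202.
have {}hS : \sum_(0 <= j < J) `|bsum b (j * (v * v)) (j.+1 * (v * v))| <= 101 * (J * v)%:R.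
  by apply: sum_bsum_le => //; rewrite -nE.
have range i : (i <= n)%N -> `|g i| <= rho%:Z.
  move=> iN.
  have H e he := minimizer_range hb hf gmin he (le_lt_trans LQ (low e he)) iN.
  by have := H 1 ltac:(by left); have := H (-1) ltac:(by right); clear; lia.
have n0 : 0 < n%:R :> R.
  rewrite lt_def ler0n andbT; apply/eqP => n0; move: QE; rewrite n0 mulr0.
  by have := le_trans (walk_loss_ge0 hb hf 0 n g) LQ; lra.
set d := dgap c f l in lmin *.
have d0 : 0 <= d := dgap_ge0 hb hf l.
have blk (d' : R) j0 : 0 <= d' -> d' <= d -> d' <= E -> (j0 <= J)%N ->
    \sum_(j0 <= j < J) d' / 2 * ((v * v)%:R - `|bsum b (j * (v * v)) (j.+1 * (v * v))|)
    <= walk_loss c b f (j0 * (v * v)) (J * (v * v)) g.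
  move=> d'0 d'd d'E j0J.
  apply: (@blocks_loss_ge _ c b f hb hf n g (v * v) j0 J d' K) => //.
  - by rewrite nE.
  - by move=> i iN; exact: le_trans d'd (lmin i iN).
  - apply: le_trans wEK; rewrite -!mulrA ler_wpM2l ?ler0n//; lra.
  by move=> i j k iN jN kN; apply: notri; exact: range.
(* Otherwise the minimizer would lose at least E/2 (n - 101 J v), which is at least E n / 4 because
   [202 <= v], against [4 * Q < E * n]. *)
have dE : d < E.
  rewrite ltNge; apply/negP => Ed.
  have := blk E 0%N (ltW E0) Ed (lexx E) (leq0n _).
  rewrite mul0n -nE -mulr_sumr sumrB sumr_const_nat subn0 => h.
  have : E / 2 * (n%:R - 101 * (J * v)%:R) <= Q.
    apply: le_trans (le_trans h LQ); rewrite ler_wpM2l ?divr_ge0 ?(ltW E0)//.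
    have -> : (v * v)%:R *+ J = n%:R :> R by rewrite -mulr_natr -natrM mulnC -nE.
    by rewrite lerB.
  have : (202 * (J * v))%:R <= n%:R :> R by rewrite ler_nat nE (mulnA J) [(202 * _)%N]mulnC leq_mul.
  rewrite natrM => h1 h2.
  have : E * n%:R / 4 <= E / 2 * (n%:R - 101 * (J * v)%:R).
    by rewrite -!mulrA ler_pM2l//; lra.
  by lra.
(* A gap below [E] makes both ends extreme, since neither value reaches [c]. *)
have high : c - E < `|f l| /\ c - E < `|f (l + 1)|.
  move: dE; rewrite /d /dgap; have := hf l; have := hf (l + 1).
  have := ler_normB (f (l + 1)) (f l); lra.
split => //.
- by rewrite ltNge; apply/negP => /near.
- by rewrite -lez_nat abszE -gi0 range.
move=> m0 m1 /andP[tm1 m10] lm0 m0n.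
have [tn gt] := tauP hl.
(* Index of the first block boundary after [m0]. *)
pose j0 := (m0 %/ (v * v)).+1.
have w0 : (0 < v * v)%N by rewrite muln_gt0 v0.
have m0j : (m0 <= j0 * (v * v))%N by apply/ltnW/ltn_ceil.
have j0m : (j0 * (v * v) <= m0 + v * v)%N.
  by rewrite /j0 mulSn addnC leq_add2r leq_trunc_div.
have j0J : (j0 <= J)%N by rewrite -(leq_pmul2r w0) -nE; exact: leq_trans j0m m0n.
have h1 := cost_edge_extend hb hf (lazy_walkS tn lz) g0 gt tm1.
have h2 := minimizer_loss_le_cost hb hf gmin nE lm0 m0j j0J.
have h3 := blk d j0 d0 (lexx d) (ltW dE) j0J.
have h4 : walk_loss c b f 0 n g = walk_loss c b f 0 (tau n g l) g +
    walk_loss c b f (tau n g l) (j0 * (v * v)) g + walk_loss c b f (j0 * (v * v)) n g.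
  have tj : (tau n g l <= j0 * (v * v))%N.
    by apply: leq_trans m0j; apply: leq_trans m10; exact: ltnW.
  have jn : (j0 * (v * v) <= n)%N by exact: leq_trans j0m m0n.
  by rewrite -!walk_loss_cat ?tj ?jn ?(leq_trans tj jn).
have h5 := walk_loss_ge0 hb hf (tau n g l) (j0 * (v * v)) g.
rewrite -nE in h3.
have h6 : d * (j0 * (v * v) - m0)%:R <= d * (v * v)%:R.
  by rewrite ler_wpM2l// ler_nat leq_subLR addnC; apply: leq_trans j0m _; rewrite addnC.
have h7 : \sum_(j0 <= j < J) `|bsum b (j * (v * v)) (j.+1 * (v * v))| <= 101 * (J * v)%:R.
  apply: le_trans hS; rewrite [leRHS](big_cat_nat (leq0n j0) j0J)/= lerDr.
  by apply: sumr_ge0 => *; exact: normr_ge0.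
have h8 := ler_wpM2l d0 h7.
move: h2 h3; rewrite -!mulr_sumr sumrB big_split/= -/d.
rewrite -/d in h1.
set S := \sum_(_ <= _ < _) `|_| in h8 *; set W := \sum_(_ <= _ < _) _.
lra.
Qed.

End Core.

(** * Events of small probability *)

Section SmallSets.
Context d (T : measurableType d) (R : realType) (P : probability T R).

(* An outer-measure bound: the events below are not shown to be measurable. *)
Definition small (e : R) (A : set T) :=
  exists C, [/\ measurable C, A `<=` C & (P C <= e%:E)%E].

Lemma small_sub e A B : A `<=` B -> small e B -> small e A.
Proof. by move=> AB [C [mC BC PC]]; exists C; split => //; exact: subset_trans BC. Qed.

Lemma small_le e e' A : e <= e' -> small e A -> small e' A.
Proof.
move=> ee [C [mC AC PC]]; exists C; split => //.
by apply: le_trans PC _; rewrite lee_fin.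
Qed.

Lemma smallU e1 e2 A B : small e1 A -> small e2 B -> small (e1 + e2) (A `|` B).
Proof.
move=> [C [mC AC PC]] [D [mD BD PD]]; exists (C `|` D); split.
- exact: measurableU.
- exact: setUSS.
- apply: le_trans (measureU2 _ mC mD) _; rewrite EFinD; exact: leeD.
Qed.

Lemma small_big (I : eqType) (s : seq I) e (A : I -> set T) :
  (forall i, i \in s -> small e (A i)) ->
  small ((size s)%:R * e) [set w | exists2 i, i \in s & A i w].
Proof.
elim: s => [|i s IH] H.
  exists set0; split => //; first by move=> w [].
  by rewrite measure0 mul0r.
have h1 : small e (A i) by apply: H; rewrite inE eqxx.
have h2 := IH (fun j js => H j (mem_behead (s := i :: s) js)).
have h3 := smallU h1 h2.
rewrite /= -natr1 mulrDl mul1r addrC; apply: small_sub h3.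
by move=> w [j]; rewrite inE => /orP[/eqP -> ?|js Aj]; [left|right; exists j].
Qed.

(** Turns a bound on the union of all bad events into an actual environment on which the pathwise
    comparison is run. *)
Lemma small_ex e A : small e A -> e < 1 -> exists w, ~ A w.
Proof.
move=> [C [mC AC PC]] e1; apply/existsNP => H.
have CT : C = setT by apply/seteqP; split => // w _; apply: AC; exact: H.
by move: PC; rewrite CT probability_setT lee_fin leNgt e1.
Qed.

Lemma small_ae (A : set T) : {ae P, forall w, A w} -> small 0 (~` A).
Proof.
by move=> [C [mC PC AC]]; exists C; split => //; rewrite PC.
Qed.

Lemma small_markov (f : T -> R) (K a : R) : 0 < a ->
  measurable_fun setT f -> (forall w, 0 <= f w) ->
  (\int[P]_w (f w)%:E <= K%:E)%E -> small (K / a) [set w | a <= f w].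
Proof.
move=> a0 mf f0 fK.
have mA : measurable [set w | a <= f w].
  rewrite (_ : [set _ | _] = f @^-1` `[a, +oo[).
    by rewrite -[X in measurable X]setTI; apply: mf.
  by apply/seteqP; split => w /=; rewrite in_itv/= andbT.
set A := [set w | a <= f w] in mA *.
exists A; split => //.
have mEf : measurable_fun setT (EFin \o f) by apply/measurable_EFinP.
rewrite EFinM lee_pdivlMr// muleC -integral_cst//.
apply: le_trans fK.
apply: (@le_trans _ _ (\int[P]_(w in A) (f w)%:E)%E).
  apply: ge0_le_integral => //; try by move=> *; rewrite lee_fin ?f0// ltW.
    exact: measurable_funS mEf.
by apply: ge0_subset_integral => // w _; rewrite lee_fin.
Qed.

Lemma integral_sum_indic (I : Type) (s : seq I) (E : I -> set T) :
  (forall i, measurable (E i)) ->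
  (\int[P]_w (\sum_(i <- s) \1_(E i) w)%:E = \sum_(i <- s) P (E i))%E.
Proof.
move=> mE.
under eq_integral do rewrite -sumEFin.
rewrite ge0_integral_sum//.
- by apply: eq_bigr => i _; rewrite integral_indic// setIT.
- by move=> i; apply/measurable_EFinP.
Qed.

(** The variance m s (1 - s) of a sum of pairwise independent indicators, bounded by the mean m
    s. *)
Lemma integral_sqr_indic (m : nat) (E : nat -> set T) (s : R) :
  (forall i, measurable (E i)) -> (forall i, P (E i) = s%:E) ->
  (forall i j, i != j -> P (E i `&` E j) = (s ^+ 2)%:E) ->
  (\int[P]_w ((\sum_(i < m) \1_(E i) w - m%:R * s) ^+ 2)%:E <= (m%:R * s)%:E)%E.
Proof.
move=> mE PE PEE.
have s0 : 0 <= s by rewrite -lee_fin -(PE 0%N).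
pose N w : R := \sum_(i < m) \1_(E i) w.
have mN : measurable_fun setT N by apply: measurable_sum => i; exact: measurable_indic.
have N0 w : 0 <= N w by apply: sumr_ge0.
set a := m%:R * s.
have a0 : 0 <= a by rewrite mulr_ge0.
have IN : (\int[P]_w (N w)%:E = a%:E)%E.
  rewrite integral_sum_indic//; under eq_bigr do rewrite PE.
  by rewrite sumEFin sumr_const card_ord /a mulr_natl.
have IN2 : (\int[P]_w ((N w) ^+ 2)%:E = (a ^+ 2 + m%:R * (s - s ^+ 2))%:E)%E.
  rewrite (_ : (fun w => _) = (fun w =>
     (\sum_(p : 'I_m * 'I_m) \1_(E p.1 `&` E p.2) w)%:E)); last first.
    apply/funext => w; congr (_%:E); rewrite expr2 /N big_distrlr/= pair_bigA/=.
    by apply: eq_bigr => p _; rewrite indicI.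
  rewrite integral_sum_indic; last by move=> p; exact: measurableI.
  rewrite (eq_bigr (fun p : 'I_m * 'I_m =>
     (s ^+ 2 + (p.1 == p.2)%:R * (s - s ^+ 2))%:E)); last first.
    move=> [i j] _ /=; case: eqVneq => [->|ij]; last by rewrite mul0r addr0 PEE.
    by rewrite setIid mul1r addrC subrK PE.
  rewrite sumEFin -(pair_bigA _ (fun i j : 'I_m => s ^+ 2 + (i == j)%:R * (s - s ^+ 2)))/=.
  congr (_%:E).
  rewrite (eq_bigr (fun i : 'I_m => m%:R * s ^+ 2 + (s - s ^+ 2))); last first.
    move=> i _; rewrite big_split/= sumr_const card_ord mulr_natl; congr (_ + _).
    rewrite (bigD1 i)//= eqxx mul1r big1 ?addr0// => j ji.
    by rewrite eq_sym (negbTE ji) mul0r.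
  by rewrite sumr_const card_ord -mulr_natl /a; ring.
have mNsq : measurable_fun setT (fun w => (N w - a) ^+ 2).
  by apply: measurable_funX; apply: measurable_funB.
(* Adding 2 a N to the square gives N^2 + a^2, so that only integrals of nonnegative functions have
   to be split. *)
have key : (\int[P]_w ((N w - a) ^+ 2)%:E + (2 * a * a)%:E =
   (a ^+ 2 + m%:R * (s - s ^+ 2) + a ^+ 2)%:E)%E.
  transitivity (\int[P]_w ((N w - a) ^+ 2 + 2 * a * N w)%:E)%E.
    under [RHS]eq_integral do rewrite EFinD.
    rewrite ge0_integralD//.
    - congr (_ + _)%E; under [RHS]eq_integral do rewrite EFinM.
      rewrite ge0_integralZl_EFin ?IN//.
      + by move=> *; rewrite lee_fin.
      + by apply/measurable_EFinP.
      + by rewrite mulr_ge0.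
    - by move=> *; rewrite lee_fin sqr_ge0.
    - by apply/measurable_EFinP.
    - by move=> *; rewrite lee_fin !mulr_ge0.
    - by apply/measurable_EFinP; apply: measurable_funM.
  rewrite (eq_integral (fun w => ((N w) ^+ 2)%:E + (a ^+ 2)%:E)%E); last first.
    by move=> w _; rewrite -EFinD; congr (_%:E); ring.
  rewrite ge0_integralD//.
  - rewrite IN2 integral_cst// [X in (_ + _ * X)%E](_ : _ = 1%E) ?mule1//.
    exact: probability_setT.
  - by move=> *; rewrite lee_fin sqr_ge0.
  - by apply/measurable_EFinP; apply: measurable_funX.
  - by move=> *; rewrite lee_fin sqr_ge0.
have {key} -> : (\int[P]_w ((N w - a) ^+ 2)%:E = (m%:R * (s - s ^+ 2))%:E)%E.
  have fin : (2 * a * a)%:E \is a fin_num by [].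
  rewrite -[LHS](addeK _ fin) key -EFinB; congr (_%:E); ring.
rewrite lee_fin /a ler_wpM2l// gerBl sqr_ge0//.
Qed.

(** A deviation of half the mean a, with variance at most a, has probability at most a / (a/2)^2. *)
Lemma small_chebyshev (m : nat) (E : nat -> set T) (s : R) :
  (forall i, measurable (E i)) -> (forall i, P (E i) = s%:E) ->
  (forall i j, i != j -> P (E i `&` E j) = (s ^+ 2)%:E) -> 0 < m%:R * s ->
  small (4 / (m%:R * s)) [set w | \sum_(i < m) \1_(E i) w <= m%:R * s / 2].
Proof.
move=> mE PE PEE ms.
set a := m%:R * s in ms *.
have h := integral_sqr_indic m mE PE PEE.
have -> : 4 / a = a / (a ^+ 2 / 4) by field; rewrite gt_eqF.
apply: small_sub (small_markov (f := fun w => (\sum_(i < m) \1_(E i) w - a) ^+ 2) _ _ _ h).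
- move=> w /=; set N := \sum_(_ < _) _ => h1; nra.
- by rewrite divr_gt0// exprn_gt0.
- apply: measurable_funX; apply: measurable_funB => //.
  by apply: measurable_sum => i; exact: measurable_indic.
- by move=> w; exact: sqr_ge0.
Qed.

End SmallSets.

(** * The tail of the density *)

Section Density.
Context (R : realType).
Variables (c q kappa : R) (rho : R -> R).
Hypothesis c0 : 0 < c.
Hypothesis q0 : 0 < q.
Hypothesis rhoN : forall x, rho (- x) = rho x.
Hypothesis rhoc : {within `]-c, c[, continuous rho}.
Hypothesis rho_gt0 : forall x, - c < x < c -> 0 < rho x.
Hypothesis rho_out : forall x, c <= `|x| -> rho x = 0.
Hypothesis rho_edge : (fun x => rho x / (`|c - x| `^ kappa)) x @[x --> c^'-] --> q.

Notation leb := (@lebesgue_measure R).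

Lemma measurable_density : measurable_fun setT rho.
Proof.
have mI : measurable (`]-c, c[%classic : set R) by [].
rewrite -(setUv `]-c, c[%classic); apply/measurable_funU => //; first exact: measurableC.
split; first exact: subspace_continuous_measurable_fun.
have : measurable_fun (~` `]-c, c[%classic) (cst 0 : R -> R) by exact: measurable_cst.
apply: eq_measurable_fun => x; rewrite inE /= in_itv/= => /negP h.
apply/esym/rho_out; by rewrite leNgt ltr_norml.
Qed.

Lemma density_ge0 x : 0 <= rho x.
Proof.
have [h|h] := ltP `|x| c; last by rewrite rho_out.
by apply/ltW/rho_gt0; rewrite -ltr_norml.
Qed.

Lemma mEdensity (A : set R) : measurable_fun A (EFin \o rho).
Proof. by apply: measurable_funS (measurableT) _ _ => //; apply/measurable_EFinP; exact: measurable_density. Qed.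

(** A zero integral would make [rho] vanish almost everywhere on an interval of positive length
    inside (-c, c). *)
Lemma density_itv_gt0 (a b : R) : - c <= a -> a < b -> b <= c ->
  (0 < \int[leb]_(x in `]a, b[) (rho x)%:E)%E.
Proof.
move=> ca ab bc.
have I0 : (0 <= \int[leb]_(x in `]a, b[) (rho x)%:E)%E.
  by apply: integral_ge0 => x _; rewrite lee_fin density_ge0.
rewrite lt_def I0 andbT; apply/eqP => E.
have : (\int[leb]_(x in `]a, b[) `|(EFin \o rho) x|)%E = 0%E.
  rewrite -{}[RHS]E; apply: eq_integral => x _ /=.
  by rewrite ger0_norm ?density_ge0.
move/(@ae_eq_integral_abs _ _ _ leb `]a, b[%classic (measurable_itv _) (EFin \o rho) (@mEdensity _)).1 => H0.
case: H0 => [C [mC C0 sub]].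
have : (leb `]a, b[%classic <= leb C)%E.
  apply: le_measure; rewrite ?inE// => x xab; apply: sub => /= h.
  have /h : `]a, b[%classic x by [].
  move=> [] e; have : 0 < rho x; last by rewrite e ltxx.
  have c1 := c0; apply: rho_gt0; move: xab; rewrite /= in_itv/= => /andP[? ?]; lra.
by rewrite C0 lebesgue_measure_itv/= lte_fin ab leNgt lte_fin subr_gt0 ab.
Qed.

Lemma density_tailN (a : R) :
  (\int[leb]_(x in `]-oo, (- a)%R[) (rho x)%:E = \int[leb]_(x in `]a, +oo[) (rho x)%:E)%E.
Proof.
have -> : `]a, +oo[%classic = (-%R : _ -> measurableTypeR R) @^-1` `]-oo, (- a)%R[.
  by apply/seteqP; split => x /=; rewrite !in_itv/= ?andbT ltrN2.
transitivity (\int[leb]_(x in (-%R : _ -> measurableTypeR R) @^-1` `]-oo, (- a)%R[)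
    ((EFin \o rho) \o -%R) x)%E; last by apply: eq_integral => x _ /=; rewrite rhoN.
rewrite -ge0_integral_pushforward//=.
- by apply: eq_measure_integral => //= A mA _; exact/esym/lebesgue_measureN.
- exact: mEdensity.
- by move=> x _; rewrite lee_fin density_ge0.
Qed.

(** Checked on half-open intervals, which determine the Lebesgue measure; it provides the
    substitution in [tail_doubling]. *)
Lemma lebesgue_measure_affine (a b : R) (A : set R) : 0 < a -> measurable A ->
  (leb A = a%:E * pushforward leb (fun x : R => (a * x + b)%R : measurableTypeR R) A)%E.
Proof.
move=> a0 mA.
pose phi0 (x : measurableTypeR R) : measurableTypeR R := a * x + b.
have mphi : measurable_fun setT phi0.
  by apply: measurable_funD => //; exact: measurable_funM.
pose mu := mscale (NngNum (ltW a0))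
  (measure_function_pushforward__canonical__measure_function_Measure leb mphi).
suff H X : ocitv X -> leb X = mu X by exact: (lebesgue_measure_unique H mA).
move=> [[u v]] _ <-.

change (leb `]u, v]%classic = a%:E * leb (phi0 @^-1` `]u, v]%classic))%E.
have -> : phi0 @^-1` `]u, v]%classic =
    `](u - b) / a, (v - b) / a]%classic.
  apply/seteqP; split => x; rewrite /phi0/= !in_itv/= ltr_pdivrMr// ler_pdivlMr// ltrBlDr lerBrDr;
  by rewrite mulrC.
rewrite !lebesgue_measure_itv/= !lte_fin ltr_pM2r ?invr_gt0// ltrD2r.
case: ifP => _; last by rewrite mule0.
by rewrite -!EFinB -EFinM; congr (_%:E); field; rewrite gt_eqF.
Qed.

Hypothesis rho_int : (\int[leb]_x (rho x)%:E = 1)%E.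

Lemma density_fin (A : set R) : measurable A ->
  (\int[leb]_(x in A) (rho x)%:E \is a fin_num)%E.
Proof.
move=> mA; rewrite ge0_fin_numE; last first.
  by apply: integral_ge0 => x _; rewrite lee_fin density_ge0.
apply: (@le_lt_trans _ _ 1%E); last exact: ltry.
rewrite -rho_int; apply: ge0_subset_integral => //; first exact: mEdensity.
by move=> x _; rewrite lee_fin density_ge0.
Qed.

(** At [t = theta] this is the p of the overview. *)
Definition upper_tail (t : R) : R := fine (\int[leb]_(x in `]c - t, +oo[) (rho x)%:E).

(** Near [c] the density lies between q/2 and 2q times |c - x|^kappa, so doubling the distance to
    [c] multiplies it by at most 4 * 2^kappa. The substitution x -> 2 x - c, which doubles that
    distance, contributes the further factor 2. *)
Lemma tail_doubling :
  exists t0 D : R, [/\ 0 < t0, 0 < D & forall t, 0 < t <= t0 -> upper_tail (2 * t) <= D * upper_tail t].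
Proof.
have q1 := q0; have c1 := c0.
have h1 : \forall x \near c^'-, rho x / (`|c - x| `^ kappa) < 2 * q.
  have qq : q < 2 * q by lra.
  by apply: (@cvgr_lt _ _ _ _ _ _ rho_edge); exact: qq.
have h2 : \forall x \near c^'-, q / 2 < rho x / (`|c - x| `^ kappa).
  have qq : q / 2 < q by lra.
  by apply: (@cvgr_gt _ _ _ _ _ _ rho_edge); exact: qq.
have [e /= e0 He] : \forall x \near c^'-, q / 2 < rho x / (`|c - x| `^ kappa) < 2 * q.
  by near=> x; apply/andP; split; near: x.
have {}He x : c - e < x < c -> q / 2 < rho x / (`|c - x| `^ kappa) < 2 * q.
  by move=> /andP[h h']; apply: He => //=; rewrite gtr0_norm; lra.
pose D' := 4 * 2 `^ kappa.
have D'0 : 0 < D' by rewrite mulr_gt0// powR_gt0.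
exists (e / 2), (2 * D'); split; [lra|lra|] => t /andP[t0 te].
have pw x : c - t < x -> rho (2 * x - c) <= D' * rho x.
  move=> tx; have [cx|cx] := leP c x.
    by rewrite !rho_out ?mulr0//; rewrite ger0_norm; lra.
  have := He x ltac:(apply/andP; split; lra).
  have := He (2 * x - c) ltac:(apply/andP; split; lra).
  have -> : `|c - (2 * x - c)| = 2 * `|c - x|.
    by rewrite !gtr0_norm; lra.
  rewrite powRM//.
  have u0 : 0 < `|c - x| `^ kappa by rewrite powR_gt0// normr_gt0 subr_eq0 gt_eqF.
  have k0 : 0 < 2 `^ kappa :> R by rewrite powR_gt0.
  move=> /andP[_ a1] /andP[a2 _].
  rewrite ltr_pdivrMr ?mulr_gt0// in a1; rewrite ltr_pdivlMr// in a2.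
  move: a1 a2; rewrite /D'.
  set U := `|c - x| `^ kappa in u0 *; set K := 2 `^ kappa in k0 *.
  move=> a1 a2; apply: ltW; apply: lt_trans a1 _.
  have : K * (q / 2 * U) < K * rho x by rewrite ltr_pM2l.
  lra.
pose phi0 (x : measurableTypeR R) : measurableTypeR R := 2 * x + (- c).
have mphi : measurable_fun setT phi0.
  by apply: measurable_funD => //; exact: measurable_funM.
have P : (\int[leb]_(x in `](c - 2 * t)%R, +oo[) (rho x)%:E =
    2%:E * \int[leb]_(x in `](c - t)%R, +oo[) (rho (2 * x - c))%:E)%E.
  have -> : `](c - t)%R, +oo[%classic =
     phi0 @^-1` `](c - 2 * t)%R, +oo[.
    by apply/seteqP; split => x; rewrite /phi0/= !in_itv/= !andbT => ?; lra.
  rewrite -[in RHS](@ge0_integral_pushforward _ _ _ _ R _ mphi leb _ (EFin \o rho))//.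
  - rewrite -[X in X%:E]/((NngNum (ler0n R 2))%:num) -ge0_integral_mscale//.
    + apply: eq_measure_integral => A mA _.
      exact: (@lebesgue_measure_affine 2 (- c) A (ltr0Sn R 1) mA).
    + exact: mEdensity.
    + by move=> x _; rewrite lee_fin density_ge0.
  - exact: mEdensity.
  - by move=> x _; rewrite lee_fin density_ge0.
rewrite -lee_fin EFinM /upper_tail !fineK; try exact: density_fin.
rewrite P EFinM -muleA lee_pmul2l//.
rewrite -ge0_integralZl_EFin//; last 3 first.
- by move=> x _; rewrite lee_fin density_ge0.
- exact: mEdensity.
- exact: ltW.
apply: ge0_le_integral => //.
- by move=> x _; rewrite lee_fin density_ge0.
- apply/measurable_EFinP; apply: measurable_funTS.
  apply: (measurableT_comp measurable_density).
  by apply: measurable_funB => //; exact: measurable_funM.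
- by apply: measurable_funeM; exact: mEdensity.
- by move=> x /=; rewrite in_itv/= andbT -EFinM lee_fin; exact: pw.
Unshelve. all: by end_near. Qed.

Lemma tail_le (s t : R) : s <= t -> upper_tail s <= upper_tail t.
Proof.
move=> st; apply: fine_le; try exact: density_fin.
apply: ge0_subset_integral => //; first exact: mEdensity.
- by move=> x _; rewrite lee_fin density_ge0.
- by move=> x /=; rewrite !in_itv/= !andbT; apply: le_lt_trans; rewrite lerD2l lerN2.
Qed.

Lemma tail_gt0 (t : R) : 0 < t -> 0 < upper_tail t.
Proof.
move=> t0; rewrite -lte_fin fineK; last exact: density_fin.
pose a := Num.max (c - t) (- c).
have ac : a < c by have c1 := c0; rewrite gt_max; apply/andP; split; lra.
apply: lt_le_trans (density_itv_gt0 _ ac (lexx c)) _; first by rewrite le_max lexx orbT.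
apply: ge0_subset_integral => //; first exact: mEdensity.
- by move=> x _; rewrite lee_fin density_ge0.
- by move=> x /=; rewrite !in_itv/= andbT gt_max => /andP[/andP[]].
Qed.

End Density.

(** * Choice of the scales *)

Lemma exp2_ge (R : realType) (x : R) : exists k : nat, x <= 2 ^+ k.
Proof.
exists (Num.truncn x).+1; apply: (@le_trans _ _ (Num.truncn x).+1%:R).
  exact/ltW/truncnS_gt.
by rewrite -natrX ler_nat ltnW// ltn_expl.
Qed.

Lemma truncnS_le (R : realType) (x : R) : 0 <= x -> (Num.truncn x).+1%:R <= x + 1.
Proof. by move=> x0; rewrite -natr1 lerD2r truncn_le. Qed.

(** [h] is the tail, [a] the probability of |F| <= c/2. The order of quantifiers is essential: [C0],
    [C1], [D0], [delta] are fixed before the block length [w] and the threshold [L], so that the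
    fluctuation error, which carries the factor D0 / delta, can be beaten by long blocks. Each bound
    by 1/20 is the probability of one bad event. *)
Lemma scale_choice (R : realType) (c a : R) (h : R -> R) :
  0 < c -> 0 < a -> (forall t, 0 < t -> 0 < h t) -> (forall s t, s <= t -> h s <= h t) ->
  (forall e, 0 < e -> exists2 t, 0 < t & h t <= e) ->
  (exists t0 D : R, [/\ 0 < t0, 1 <= D &
    forall k t, 0 < t -> 2 ^+ k * t <= t0 -> h (2 ^+ k * t) <= D ^+ k * h t]) ->
  exists C0 C1 D0 delta : R, [/\ 0 < C1, 0 < D0, 0 < delta &
  forall (w : nat) (L : R), (0 < w)%N -> 1 <= L ->
  exists (theta r K : R) (J rho m k : nat),
    let n := (J.+1 * w)%N in
    [/\ [/\ 0 < theta, L * theta <= 1, L <= r, rho.+1%:R <= C1 * r + 1 &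
            r < theta * n%:R <= 2 * r],
        [/\ 4 / (m.+1%:R * h theta ^+ 2) <= 20^-1, (2 * m.+1 <= n)%N &
            2 * c * (2 * m.+1)%:R + 2 * theta * n%:R <= C0 * r],
        4 / (rho.+1%:R * a) <= 20^-1 /\ C0 * r < c / 2 * (rho.+1%:R * a / 2),
        [/\ 4 * (C0 * r) < D0 * theta * n%:R, w%:R * (D0 * theta) / 2 <= K,
            D0 * theta <= K, K <= c &
            ((2 * rho.+1).+1 * ((2 * w).+1 * (2 * w).+1))%:R * (2 * h K) ^+ 3 <= 20^-1] &
        (2 * k).+1%:R * (2 * h (D0 * theta)) ^+ 2 <= 20^-1 /\
        forall x : nat, x%:R <= delta * r -> (x <= k)%N]].
Proof.
move=> c0 a0 h_gt0 h_le h_small [t0 [D [t00 D1 dbl]]].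
have D00 : 0 < D by apply: lt_le_trans D1.
(* 324 c pays, at [2 * c] per step, for a journey over at most 162 r sites; 4 pays for staying
   [n <= 2 r / theta] steps on an edge of gap 2 theta. *)
have [C0 C0E] : {C0 : R | C0 = 324 * c + 4} by eexists.
have C00 : 0 < C0 by rewrite C0E; lra.
(* Leaving the range costs c/4 times [a] times its size; any factor above 4 makes this exceed
   [C0 * r]. *)
have [C1 C1E] : {C1 : R | C1 * a = 5 * C0 / c}.
  by exists (5 * C0 / c / a); rewrite divfK// gt_eqF.
have C1a : 80 <= C1 * a by rewrite C1E ler_pdivlMr// C0E; lra.
have C10 : 0 < C1 by rewrite -(pmulr_lgt0 _ a0); apply: lt_le_trans C1a; rewrite ltr0n.
(* [D0] and later [K0] are powers of two, so that iterated doubling compares the tails at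
   [D0 * theta] and [K0 * theta] with the tail at [theta]. *)
have [k1 Hk1] := exp2_ge (4 * C0).
have [D0 D0E] : {D0 : R | D0 = 2 ^+ k1} by eexists.
rewrite -D0E in Hk1.
have D0p : 0 < D0 by rewrite D0E; exact: exprn_gt0.
have [W1 W1E] : {W1 : R | W1 = D ^+ k1 * D ^+ k1} by eexists.
have W10 : 0 < W1 by rewrite W1E mulr_gt0 ?exprn_gt0.
(* With r g^2 = 1 the bound for extreme edges within [delta * r] is 8 delta W1 + 4 W1 g^2; the first
   term is 1/40, which leaves 1/40 for the second. *)
have [delta deltaE] : {delta : R | delta * W1 = 320^-1}.
  by exists (320^-1 / W1); rewrite divfK// gt_eqF.
have delta0 : 0 < delta.
  by rewrite -(pmulr_lgt0 _ W10) deltaE invr_gt0 ltr0n.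
exists C0, C1, D0, delta; split => // w L w0 L1.
have wR : 0 < w%:R :> R by rewrite ltr0n.
have L0 : 0 < L by lra.
have [k2 Hk2] := exp2_ge (w%:R * D0 + D0).
have [K0 K0E] : {K0 : R | K0 = 2 ^+ k2} by eexists.
rewrite -K0E in Hk2.
have K0p : 0 < K0 by rewrite K0E; exact: exprn_gt0.
have [V VE] : {V : R | V = ((2 * w).+1 * (2 * w).+1)%:R} by eexists.
have V0 : 0 < V by rewrite VE ltr0n.
have [X XE] : {X : R | X = (D ^+ k2) ^+ 3} by eexists.
have X0 : 0 < X by rewrite XE !exprn_gt0.
(* The triple event has probability at most W2 r g^3 = W2 g, hence it is rare once [g] is small. *)
have [W2 W2E] : {W2 : R | W2 = (2 * C1 + 5) * V * (8 * X)} by eexists.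
have W20 : 0 < W2.
  have z1 : 0 < 2 * C1 + 5 by clear -C10; lra.
  have z2 : 0 < 8 * X by clear -X0; lra.
  by rewrite W2E; apply: mulr_gt0 => //; exact: mulr_gt0.
have p1 : 0 < 20 * W2 by clear -W20; lra.
have p2 : 0 < 160 * W1 by clear -W10; lra.
have p3 : 0 < 200 + L + w%:R by clear -L0 wR; lra.
have [e [e0 e1 eW2 eW1 eL]] : exists e : R, [/\ 0 < e, e <= 1, e * (20 * W2) <= 1,
    e * (160 * W1) <= 1 & e * L <= 1].
  exists (Num.min (Num.min 1 (1 / (20 * W2))) (Num.min (1 / (160 * W1)) (1 / L))).
  split; rewrite -?ler_pdivlMr ?ge_min ?lexx ?orbT//.
  by rewrite !lt_min ltr01 !divr_gt0.
have [t tp te] := h_small _ e0.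
have [theta [thp tht th1 thc thK]] : exists theta : R, [/\ 0 < theta, theta <= t,
    theta * (200 + L + w%:R) <= 1, theta * K0 <= c & theta * K0 <= t0].
  exists (Num.min (Num.min t (1 / (200 + L + w%:R))) (Num.min (c / K0) (t0 / K0))).
  split; rewrite -?ler_pdivlMr ?ge_min ?lexx ?orbT//.
  by rewrite !lt_min tp !divr_gt0.
have [g gE] : {g : R | g = h theta} by eexists.
have g0 : 0 < g by rewrite gE h_gt0.
have ge : g <= e by rewrite gE; apply: le_trans te; exact: h_le.
have g1 : g <= 1 by apply: le_trans e1.
have gW2 : g * (20 * W2) <= 1 by apply: le_trans eW2; rewrite ler_pM2r.
have gW1 : g * (160 * W1) <= 1 by apply: le_trans eW1; rewrite ler_pM2r.
have gL : g * L <= 1 by apply: le_trans eL; rewrite ler_pM2r.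
have [r rE] : {r : R | r * g ^+ 2 = 1}.
  by exists (1 / g ^+ 2); rewrite divfK// gt_eqF// exprn_gt0.
have gg0 : 0 < g ^+ 2 by rewrite exprn_gt0.
have Lr : L <= r.
  rewrite -(ler_pM2r gg0) rE expr2 mulrA; apply: le_trans g1.
  by rewrite -[leRHS]mul1r ler_pM2r// mulrC.
have r1 : 1 <= r by apply: le_trans Lr.
have r0 : 0 < r by apply: lt_le_trans r1.
have tw0 : 0 < theta * w%:R by rewrite mulr_gt0.
have tw1 : theta * w%:R <= 1.
  by apply: le_trans th1; rewrite ler_pM2l//; clear -L0; lra.
have tL1 : L * theta <= 1.
  by rewrite mulrC; apply: le_trans th1; rewrite ler_pM2l//; clear -wR; lra.
have t200 : theta * 200 <= 1.
  by apply: le_trans th1; rewrite ler_pM2l//; clear -wR L0; lra.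
pose J := Num.truncn (r / (theta * w%:R)).
have Jlo : r < theta * (J.+1 * w)%:R.
  by rewrite natrM mulrCA -ltr_pdivrMr//; exact: truncnS_gt.
have Jhi : theta * (J.+1 * w)%:R <= 2 * r.
  have : J.+1%:R <= r / (theta * w%:R) + 1.
    by apply: truncnS_le; rewrite divr_ge0 ?ltW.
  rewrite -(ler_pM2r tw0) mulrDl divfK ?gt_eqF// mul1r natrM => h2.
  rewrite mulrCA; apply: le_trans h2 _; clear -tw1 r1; lra.
pose rho := Num.truncn (C1 * r).
have C1r : 0 <= C1 * r by rewrite mulr_ge0 ?ltW.
have rhi : rho.+1%:R <= C1 * r + 1 by exact: truncnS_le.
have rlo : C1 * r < rho.+1%:R by exact: truncnS_gt.
(* 80 = 4 * 20: the expected number of good edges exceeds 80, so Chebyshev gives 1/20. *)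
pose m := Num.truncn (80 * r).
have r80 : 0 <= 80 * r by clear -r0; lra.
have mhi : m.+1%:R <= 80 * r + 1 by exact: truncnS_le.
have mlo : 80 * r < m.+1%:R by exact: truncnS_gt.
pose k := Num.truncn (delta * r).
have dr0 : 0 <= delta * r by rewrite mulr_ge0 ?ltW.
have m2 : (2 * m.+1)%:R <= 162 * r by rewrite natrM; clear -mhi r1; lra.
have n0 : 0 < (J.+1 * w)%:R :> R by rewrite ltr0n muln_gt0 w0.
exists theta, r, (K0 * theta), J, rho, m, k; split.
- by split => //; rewrite Jlo.
- split.
  + rewrite -gE ler_pdivrMr ?mulr_gt0 ?ltr0n//.
    have : 80 * r * g ^+ 2 <= m.+1%:R * g ^+ 2 by rewrite ler_pM2r// ltW.
    rewrite -mulrA rE mulr1; clear; lra.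
  + rewrite -(ler_nat R); apply: le_trans m2 _.
    rewrite -(ler_pM2l thp); apply: ltW; apply: le_lt_trans Jlo.
    rewrite mulrA -[leRHS]mul1r ler_pM2r//.
    by clear -t200 thp; lra.
  + have : 2 * c * (2 * m.+1)%:R <= 2 * c * (162 * r).
      by rewrite ler_pM2l//; clear -c0; lra.
    rewrite C0E -(mulrA 2 theta); clear -Jhi; lra.
- have ra : C1 * r * a < rho.+1%:R * a by rewrite ltr_pM2r.
  have Ca : C1 * r * a = 5 * C0 / c * r by rewrite mulrAC C1E.
  split.
    rewrite ler_pdivrMr ?mulr_gt0 ?ltr0n//.
    have : 80 * r <= C1 * r * a by rewrite mulrAC ler_pM2r.
    clear -ra r1; lra.
  have : c * (C1 * r * a) < c * (rho.+1%:R * a) by rewrite ltr_pM2l.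
  have -> : c * (C1 * r * a) = 5 * (C0 * r).
    by rewrite Ca; field; rewrite gt_eqF.
  have : 0 < C0 * r by rewrite mulr_gt0.
  clear; lra.
- split.
  + rewrite -mulrA; apply: (@le_lt_trans _ _ (D0 * r)).
      by rewrite mulrA ler_pM2r.
    by rewrite ltr_pM2l.
  + rewrite !mulrA mulrAC ler_pM2r//; clear -Hk2 D0p wR.
    have : 0 <= w%:R * D0 by rewrite mulr_ge0 ?ltW.
    lra.
  + rewrite ler_pM2r//; apply: le_trans Hk2; rewrite lerDr mulr_ge0 ?ltW//.
  + by rewrite mulrC.
  + have hK : 2 * h (K0 * theta) <= 2 * (D ^+ k2 * g).
      by rewrite ler_pM2l// gE K0E; apply: dbl => //; rewrite mulrC -K0E.
    have hK3 : (2 * h (K0 * theta)) ^+ 3 <= 8 * X * (g * g ^+ 2).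
      rewrite XE; apply: (@le_trans _ _ ((2 * (D ^+ k2 * g)) ^+ 3)).
        rewrite lerXn2r// nnegrE mulr_ge0 ?mulr_ge0 ?exprn_ge0 ?(ltW g0) ?(ltW D00)//.
        by apply/ltW/h_gt0; rewrite mulr_gt0.
      by rewrite le_eqVlt; apply/orP; left; apply/eqP; ring.
    have cnt : ((2 * rho.+1).+1 * ((2 * w).+1 * (2 * w).+1))%:R <= (2 * C1 + 5) * r * V.
      rewrite natrM -VE ler_pM2r// -natr1 natrM; clear -rhi r1; lra.
    apply: (@le_trans _ _ ((2 * C1 + 5) * r * V * (8 * X * (g * g ^+ 2)))).
      apply: ler_pM => //; rewrite exprn_ge0 ?mulr_ge0//.
      by apply/ltW/h_gt0; rewrite mulr_gt0.
    have -> : (2 * C1 + 5) * r * V * (8 * X * (g * g ^+ 2)) = W2 * g * (r * g ^+ 2).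
      by rewrite W2E; ring.
    rewrite rE; clear -gW2; lra.
- split; last by move=> x xd; rewrite truncn_ge_nat.
  have KD : D0 <= K0 by apply: le_trans Hk2; rewrite lerDr mulr_ge0 ?ltW.
  have hE : 2 * h (D0 * theta) <= 2 * (D ^+ k1 * g).
    rewrite ler_pM2l// gE D0E; apply: dbl => //; rewrite -D0E.
    by apply: le_trans thK; rewrite [leRHS]mulrC ler_pM2r.
  have hE2 : (2 * h (D0 * theta)) ^+ 2 <= 4 * W1 * g ^+ 2.
    rewrite W1E; apply: (@le_trans _ _ ((2 * (D ^+ k1 * g)) ^+ 2)).
      rewrite lerXn2r// nnegrE mulr_ge0 ?mulr_ge0 ?exprn_ge0 ?(ltW g0) ?(ltW D00)//.
      by apply/ltW/h_gt0; rewrite mulr_gt0.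
    by rewrite le_eqVlt; apply/orP; left; apply/eqP; ring.
  have kle : k%:R <= delta * r by rewrite truncn_le.
  have cnt : (2 * k).+1%:R <= 2 * (delta * r) + 1.
    by rewrite -natr1 natrM; clear -kle; lra.
  apply: (@le_trans _ _ ((2 * (delta * r) + 1) * (4 * W1 * g ^+ 2))).
    by apply: ler_pM => //; rewrite exprn_ge0// mulr_ge0//; apply/ltW/h_gt0; rewrite mulr_gt0.
  have -> : (2 * (delta * r) + 1) * (4 * W1 * g ^+ 2) =
     8 * (delta * W1) * (r * g ^+ 2) + 4 * W1 * (g * g) by ring.
  rewrite rE deltaE.
  have : 4 * W1 * (g * g) <= 4 * W1 * g.
    rewrite ler_pM2l; last by clear -W10; lra.
    by rewrite -[leRHS]mul1r ler_pM2r.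
  clear -gW1; lra.
Qed.

(** * Measurability and invariance of the law *)

Section MinActionMeasurable.
Context d (T : measurableType d) (R : realType) (b f : int -> T -> R).
Hypothesis mb : forall i, measurable_fun setT (b i).
Hypothesis mf : forall x, measurable_fun setT (f x).

Lemma measurable_action n g : measurable_fun setT (fun w => action (b^~ w) (f^~ w) n g).
Proof. by apply: measurable_sum => i; exact: measurable_funM. Qed.

Lemma eq_action (b' f' : int -> R) n g h : (forall i, (i <= n)%N -> g i = h i) ->
  action b' f' n g = action b' f' n h.
Proof.
by move=> gh; apply: eq_big_nat => i /andP[_ iN]; rewrite gh// -ltnS.
Qed.

Lemma lazy_walk_le n (g : nat -> int) i : lazy_walk n g -> g 0%N = 0 -> (i <= n)%N ->
  `|g i| <= i%:Z.
Proof.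
move=> lz g0; elim: i => [|i IH] iN; first by rewrite g0 normr0.
by have := IH (ltnW iN); have := lz i iN; lia.
Qed.

(** Up to time [n] only sites in [-n, n] are visited, so the actions are bounded below in an
    arbitrary environment and [inf] behaves as an infimum. *)
Lemma action_ge (b' f' : int -> R) n g : lazy_walk n g -> g 0%N = 0 ->
  - (\sum_(1 <= i < n.+1) `|b' i%:Z| * \sum_(j < n.*2.+1) `|f' (j%:Z - n%:Z)|)
     <= action b' f' n g.
Proof.
move=> lz g0; rewrite -sumrN; apply: ler_sum_nat => i /andP[_ iN].
have gi : (`|(g i + n%:Z)%R| < n.*2.+1)%N.
  by have := lazy_walk_le lz g0 (iN : (i <= n)%N); lia.
have : `|f' (g i)| <= \sum_(j < n.*2.+1) `|f' (j%:Z - n%:Z)|.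
  rewrite (bigD1 (Ordinal gi))//= (_ : `|(g i + n%:Z)%R|%N%:Z - n%:Z = g i); last first.
    by have := lazy_walk_le lz g0 (iN : (i <= n)%N); lia.
  by rewrite lerDl sumr_ge0.
move/(ler_wpM2l (normr_ge0 (b' i%:Z))); rewrite -normrM => h.
by rewrite lerNl; apply: le_trans h; rewrite -normrN ler_norm.
Qed.

Lemma min_action_lt (b' f' : int -> R) n k g t : lazy_walk n g -> g 0%N = 0 -> g n = k ->
  min_action b' f' n k < t <->
  exists h, [/\ lazy_walk n h, h 0%N = 0, h n = k & action b' f' n h < t].
Proof.
move=> lz g0 gn; rewrite /min_action; set A := [set _ | _ in _].
have A0 : A !=set0 by exists (action b' f' n g), g.
have Alb : has_lbound A.
  by eexists => _ [h [lh [h0 _]] <-]; exact: action_ge.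
split.
  move=> /(inf_lt A0)[_ [h [lh [h0 hn]] <-] ht].
  by exists h.
by move=> [h [lh h0 hn ht]]; apply: le_lt_trans ht; apply: ge_inf => //; exists h.
Qed.

(** Walks are functions on all of [nat], but the action reads only their first [n + 1] values;
    finite sequences therefore suffice and the union is countable. The default 0 of [nth] fills
    irrelevant times. *)
Lemma measurable_min_action n k :
  measurable_fun setT (fun w => min_action (b^~ w) (f^~ w) n k).
Proof.
have [[g [lz g0 gn]]|H] := pselect (exists g, [/\ lazy_walk n g, g 0%N = 0 & g n = k]); last first.
  apply: (eq_measurable_fun (cst (inf set0 : R))); last exact: measurable_cst.
  move=> w _; rewrite /min_action /=; congr inf; apply/esym; rewrite -subset0.
  by move=> y [h [lh [h0 hn]] _]; apply: H; exists h.
move=> mT; apply: (measurability _ (RGenInftyO.measurableE R)) => //.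
move=> _ [_ [t ->] <-]; rewrite setTI.
pose S (s : seq int) : set T := if pselect (lazy_walk n (nth 0 s) /\ nth 0 s 0 = 0 /\ nth 0 s n = k)
  then [set w | action (b^~ w) (f^~ w) n (nth 0 s) < t] else set0.
rewrite (_ : _ @^-1` _ = \bigcup_s S s).
  apply: countable_bigcupT_measurable; first exact: countableP.
  move=> s; rewrite /S; case: pselect => a /=; last exact: measurable0.
  rewrite (_ : [set _ | _] = (fun w => action (b^~ w) (f^~ w) n (nth 0 s)) @^-1` `]-oo, t[).
    by rewrite -[X in measurable X]setTI; apply: measurable_action.
  by apply/seteqP; split => w /=; rewrite in_itv.
apply/seteqP; split => w /=; rewrite in_itv/= (min_action_lt _ _ _ lz g0 gn).
  move=> [h [lh h0 hn ht]]; exists (mkseq h n.+1) => //.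
  have E i : (i <= n)%N -> nth 0 (mkseq h n.+1) i = h i by move=> iN; rewrite nth_mkseq.
  rewrite /S; case: pselect => [_|] /=.
    by rewrite (@eq_action _ _ n _ h).
  by case; rewrite !E//; split => // i iN; rewrite !E ?(ltnW iN)//; exact: lh.
move=> [s _]; rewrite /S; case: pselect => // -[ls [s0 sn]] /= st.
by exists (nth 0 s).
Qed.

End MinActionMeasurable.

Section Law.
Context d (T : measurableType d) (R : realType) (P : probability T R).
Context (I : choiceType) (X : I -> T -> R).
Hypothesis mX : forall j, measurable_fun setT (X j).
Hypothesis indX : mutually_independent P X.
Variable (s : I -> I).
Hypothesis sinj : injective s.
Hypothesis lawX : forall j A, measurable A -> P (X (s j) @^-1` A) = P (X j @^-1` A).

(** The pi-system of finite-dimensional cylinders; the family [A] is total but is read only on the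
    finite list [r]. *)
Definition rectangles : set (set (I -> R)) := [set E | exists (r : seq I) (A : I -> set R),
  [/\ uniq r, forall j, measurable (A j) & E = [set e | forall j, j \in r -> A j (e j)]]].

Notation Env := (g_sigma_algebraType rectangles).

Lemma setI_rectangles : setI_closed rectangles.
Proof.
move=> _ _ [r [A [ur mA ->]]] [r' [A' [ur' mA' ->]]].
exists (undup (r ++ r')), (fun j => (if j \in r then A j else setT) `&`
  (if j \in r' then A' j else setT)); split.
- exact: undup_uniq.
- by move=> j; apply: measurableI; case: ifP.
apply/seteqP; split => e /=.
  move=> [h1 h2] j; rewrite mem_undup mem_cat => _.
  by split; case: ifP => // ?; [exact: h1|exact: h2].
move=> h; split => j jr; have := h j; rewrite mem_undup mem_cat jr ?orbT => /(_ isT)[].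
  by [].
by [].
Qed.

Lemma measurable_coord (j : I) : measurable_fun setT (fun e : Env => (e : I -> R) j).
Proof.
move=> _ A mA; rewrite setTI; apply: sub_sigma_algebra.
exists [:: j], (fun=> A); split => //.
apply/seteqP; split => e /=; first by move=> eA i; rewrite inE => /eqP ->.
by apply; rewrite inE.
Qed.

Let rect_preimage (r : seq I) (Y : I -> T -> R) (A : I -> set R) :
  (fun w => fun j => Y j w) @^-1` [set e | forall j, j \in r -> A j (e j)] =
  \bigcap_(j in [set` r]) (Y j @^-1` A j).
Proof. by apply/seteqP; split => w /= h j /h. Qed.

Lemma measurable_env (Y : I -> T -> R) : (forall j, measurable_fun setT (Y j)) ->
  measurable_fun setT (fun w => (fun j => Y j w) : Env).
Proof.
move=> mY; apply: (@measurability _ _ T Env setT _ rectangles) => //.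
move=> _ [_ [r [A [ur mA ->]]] <-]; rewrite setTI rect_preimage.
rewrite bigcap_seq; apply: bigsetI_measurable => j _.
by rewrite -[X in measurable X]setTI; exact: mY.
Qed.

(** Both laws factor on rectangles, with equal factors because [s] preserves the one-coordinate
    laws; injectivity keeps the reindexed coordinates distinct, so that independence applies.
    Rectangles determine the measure. *)
Lemma law_reindex (E : set (I -> R)) : measurable (E : set Env) ->
  P ((fun w => fun j => X j w) @^-1` E) = P ((fun w => fun j => X (s j) w) @^-1` E).
Proof.
move=> mE.
have m1 := measurable_env mX.
have m2 := measurable_env (fun j => mX (s j)).
pose mu1 := measure_function_pushforward__canonical__measure_function_Measure P m1.
pose mu2 := measure_function_pushforward__canonical__measure_function_Measure P m2.
suff : mu1 E = mu2 E by [].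
apply: (@measure_unique _ R Env rectangles (fun=> setT) erefl setI_rectangles _ _ mu1 mu2) => //.
- by move=> _; exists [::], (fun=> setT); split => //; apply/seteqP.
- by rewrite bigcup_const.
- move=> _ [r [A [ur mA ->]]].
  change (P ((fun w => fun j => X j w) @^-1` [set e | forall j, j \in r -> A j (e j)]) =
    P ((fun w => fun j => X (s j) w) @^-1` [set e | forall j, j \in r -> A j (e j)])).
  rewrite !rect_preimage indX//.
  (* The sets [A] transported along [s], with the whole line off the image of [r]. *)
  pose A' i := if pselect (exists2 j, j \in r & s j = i) is left h then A (s2val (cid2 h)) else setT.
  have A'E j : j \in r -> A' (s j) = A j.
    move=> jr; rewrite /A'; case: pselect => [h|]; last by case; exists j.
    by case: cid2 => /= j' _ /sinj ->.
  have -> : \bigcap_(j in [set` r]) (X (s j) @^-1` A j) =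
     \bigcap_(i in [set` map s r]) (X i @^-1` A' i).
    apply/seteqP; split => w /= h i.
      by move=> /= /mapP[j jr ->]; rewrite /= A'E//; exact: h.
    by move=> /= ir; have := h (s i) (map_f s ir); rewrite /= A'E.
  rewrite indX ?map_inj_uniq//; last first.
    by move=> j; rewrite /A'; case: pselect.
  rewrite big_map big_seq [RHS]big_seq; apply: eq_bigr => j jr.
  by rewrite A'E// lawX.
- by move=> _; rewrite (_ : mu1 setT = P setT)// probability_setT ltry.
Qed.

End Law.

Section Egorov.
Context d (T : measurableType d) (R : realType) (P : probability T R).

(** The limits are used at times computed from the random site ell, so they must hold for all
    [m >= N] at once. Continuity from above along the decreasing tail events gives this. *)
Lemma small_eventually_far (u : nat -> T -> R) (a : R) (eta e : R) :
  (forall n, measurable_fun setT (u n)) ->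
  {ae P, forall w, u ^~ w @ \oo --> a} -> 0 < eta -> 0 < e ->
  exists N, small P e [set w | exists2 m, (N <= m)%N & eta < `|u m w - a|].
Proof.
move=> mu uc eta0 e0.
pose C N := \bigcup_(m in [set m | (N <= m)%N]) [set w | eta < `|u m w - a|].
have mS m : measurable [set w | eta < `|u m w - a|].
  rewrite (_ : [set _ | _] = (fun w => `|u m w - a|) @^-1` `]eta, +oo[).
    rewrite -[X in measurable X]setTI.
    have : measurable_fun setT (fun w => `|u m w - a|).
      by apply: measurableT_comp => //; exact: measurable_funB.
    by apply.
  by apply/seteqP; split => w /=; rewrite in_itv/= andbT.
have mC N : measurable (C N) by apply: bigcup_measurable.
have mCC : measurable (\bigcap_N C N) by exact: bigcap_measurableType.
have CC0 : P (\bigcap_N C N) = 0%E.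
  case: uc => D [mD D0 sub]; apply/eqP; rewrite eq_le measure_ge0 andbT.
  rewrite -D0; apply: le_measure; rewrite ?inE// => w Cw; apply: sub => /= cv.
  have : \forall m \near \oo, `|u m w - a| <= eta.
    by apply: (@cvgr_distC_le _ _ _ _ _ _ _ cv).
  move=> [N _ HN]; have [m /= Nm] := Cw N I.
  by rewrite ltNge (HN m Nm).
have cv : P \o C @ \oo --> P (\bigcap_N C N).
  apply: nonincreasing_cvg_mu => //.
    by apply: (@le_lt_trans _ _ 1%E); [exact: probability_le1|exact: ltry].
  by move=> m n mn; apply/subsetPset => w [k /= nk h]; exists k => //=; exact: leq_trans nk.
rewrite CC0 in cv.
have [N _ HN] : \forall n \near \oo, (P (C n) < e%:E)%E.
  apply: (cv [set x | (x < e%:E)%E]); apply: open_nbhs_nbhs; split; first exact: open_ereal_lt_ereal.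
  by rewrite /= lte_fin.
exists N, (C N); split => //.
- by apply: ltW; exact: HN N (leqnn _).
Qed.

End Egorov.

Lemma round0N (R : realType) (x : R) : round0 (- x) = - round0 x.
Proof.
rewrite /round0 oppr_ge0; case: (ltgtP x 0) => [h|h|->].
- by rewrite ceilNfloor opprK.
- by rewrite ceilNfloor opprK.
- by rewrite oppr0 floor0.
Qed.

Lemma min_action_reflect (R : realType) (b f : int -> R) n k :
  min_action b (fun x => f (- x)) n k = min_action b f n (- k).
Proof.
have lazyN g : lazy_walk n g -> lazy_walk n (fun i => - g i).
  by move=> lz i /lz; rewrite -opprD normrN.
rewrite /min_action; congr inf; apply/seteqP; split => _ [g [lz [g0 gn]] <-].
  exists (fun i => - g i) => //; split; [exact: lazyN|by rewrite g0 gn oppr0].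
exists (fun i => - g i); first by split; [exact: lazyN|rewrite g0 gn oppr0 opprK].
by apply: eq_bigr => i _; rewrite opprK.
Qed.

(** If a < b, then for a common large [n] being below the midpoint would be likely for [u n] and
    unlikely for [v n]. *)
Lemma eq_law_limit_le d (T : measurableType d) (R : realType) (P : probability T R)
    (u v : nat -> T -> R) (a b : R) :
  (forall n, measurable_fun setT (u n)) -> (forall n, measurable_fun setT (v n)) ->
  (forall n t, P [set w | u n w < t] = P [set w | v n w < t]) ->
  {ae P, forall w, u ^~ w @ \oo --> a} -> {ae P, forall w, v ^~ w @ \oo --> b} ->
  b <= a.
Proof.
move=> mu mv uv ua vb; rewrite leNgt; apply/negP => ab.
pose e := (b - a) / 4; have e0 : 0 < e by rewrite /e; lra.
have q : 0 < 4^-1 :> R by [].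
have [N1 s1] := small_eventually_far mu ua e0 q.
have [N2 s2] := small_eventually_far mv vb e0 q.
pose n := maxn N1 N2; pose t := (a + b) / 2.
have mlt (X : T -> R) : measurable_fun setT X -> measurable [set w | X w < t].
  move=> mX; rewrite (_ : [set _ | _] = X @^-1` `]-oo, t[).
    by rewrite -[X in measurable X]setTI; exact: mX.
  by apply/seteqP; split => w /=; rewrite in_itv.
have s3 : small P 4^-1 [set w | u n w < t].
  exists [set w | u n w < t]; split => //; first exact: mlt.
  rewrite uv; case: s2 => C [mC sC PC]; apply: le_trans PC.
  apply: le_measure; rewrite ?inE//; first exact: mlt.
  move=> w /= vt; apply: sC; exists n; first exact: leq_maxr.
  have h : e < b - v n w by move: vt; rewrite /t /e; lra.
  by rewrite distrC; apply: lt_le_trans h (ler_norm _).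
have s4 : small P 4^-1 [set w | t <= u n w].
  apply: small_sub s1 => w /= ut; exists n; first exact: leq_maxl.
  have h : e < u n w - a by move: ut; rewrite /t /e; lra.
  exact: lt_le_trans h (ler_norm _).
have [|w] := small_ex (smallU s3 s4); first by lra.
by apply; rewrite /=; case: (ltP (u n w) t); [left|right].
Qed.

(** Reflecting the sites preserves the joint law of F and B and exchanges the endpoints k and -k. *)
Lemma limit_reflect d (T : measurableType d) (R : realType) (P : probability T R)
    (F B : int -> T -> R) (nu : set R -> \bar R) (alpha a b : R) :
  (forall x, measurable_fun setT (F x)) -> (forall i, measurable_fun setT (B i)) ->
  (forall x (A : set R), measurable A -> P (F x @^-1` A) = nu A) ->
  mutually_independent P
    (fun j : int + int => match j with inl x => F x | inr i => B i end) ->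
  {ae P, forall w, (fun n : nat =>
     min_action (B^~ w) (F^~ w) n (round0 (alpha * n%:R)) / n%:R) @ \oo --> a} ->
  {ae P, forall w, (fun n : nat =>
     min_action (B^~ w) (F^~ w) n (round0 (- alpha * n%:R)) / n%:R) @ \oo --> b} ->
  a = b.
Proof.
move=> mF mB lawF ind ua ub.
pose X (j : int + int) := match j with inl x => F x | inr i => B i end.
pose s (j : int + int) : int + int := match j with inl x => inl (- x) | inr i => inr i end.
have mX j : measurable_fun setT (X j) by case: j.
have sinj : injective s.
  by move=> [x|x] [y|y] //= [] /oppr_inj ->.
have lawX j A : measurable A -> P (X (s j) @^-1` A) = P (X j @^-1` A).
  by case: j => [x|i] mA //=; rewrite !lawF.
have mu (al : R) n : measurable_fun setT (fun w =>
    min_action (B^~ w) (F^~ w) n (round0 (al * n%:R)) / n%:R).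
  by apply: measurable_funM => //; exact: measurable_min_action.
have law n t : P [set w | min_action (B^~ w) (F^~ w) n (round0 (alpha * n%:R)) / n%:R < t]
    = P [set w | min_action (B^~ w) (F^~ w) n (round0 (- alpha * n%:R)) / n%:R < t].
  pose Env := g_sigma_algebraType (@rectangles R (int + int)%type).
  pose E : set Env := [set e | min_action (fun i => (e : int + int -> R) (inr i))
    (fun x => (e : int + int -> R) (inl x)) n (round0 (alpha * n%:R)) / n%:R < t].
  have mE : measurable E.
    have mf : measurable_fun setT (fun e : Env => min_action (fun i => (e : int + int -> R) (inr i))
        (fun x => (e : int + int -> R) (inl x)) n (round0 (alpha * n%:R)) / n%:R).
      apply: measurable_funM => //.
      apply: (@measurable_min_action _ Env R (fun i e => (e : int + int -> R) (inr i))
        (fun x e => (e : int + int -> R) (inl x))) => j; exact: measurable_coord.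
    rewrite (_ : E = (fun e : Env => min_action (fun i => (e : int + int -> R) (inr i))
        (fun x => (e : int + int -> R) (inl x)) n (round0 (alpha * n%:R)) / n%:R) @^-1` `]-oo, t[).
      by rewrite -[X in measurable X]setTI; exact: mf.
    by apply/seteqP; split => e /=; rewrite in_itv.
  have := law_reindex mX ind sinj lawX mE.
  rewrite /preimage /E /X /=.
  rewrite mulNr round0N => ->; congr (P _); apply/seteqP.
  by split => w /=; rewrite -(min_action_reflect (B^~ w) (F^~ w)).
apply/eqP; rewrite eq_le; apply/andP; split.
  by apply: (@eq_law_limit_le _ _ _ P _ _ b a (mu (- alpha)) (mu alpha) _ ub ua) => n t; rewrite law.
by apply: (@eq_law_limit_le _ _ _ P _ _ a b (mu alpha) (mu (- alpha)) _ ua ub) => n t; rewrite law.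
Qed.

(** * Typical environments *)

Section Environment.
Context d (T : measurableType d) (R : realType) (P : probability T R).
Variables (c : R) (rho : R -> R) (F B : int -> T -> R).
Hypothesis c0 : 0 < c.
Hypothesis rhoN : forall x, rho (- x) = rho x.
Hypothesis rhoc : {within `]-c, c[, continuous rho}.
Hypothesis rho_gt0 : forall x, - c < x < c -> 0 < rho x.
Hypothesis rho_out : forall x, c <= `|x| -> rho x = 0.
Hypothesis mF : forall x, measurable_fun setT (F x).
Hypothesis mB : forall i, measurable_fun setT (B i).
Hypothesis lawF : forall x (A : set R), measurable A ->
  P (F x @^-1` A) = (\int[lebesgue_measure]_(y in A) (rho y)%:E)%E.
Hypothesis B1 : forall i, P (B i @^-1` [set 1]) = (2^-1)%:E.
Hypothesis BN1 : forall i, P (B i @^-1` [set -1]) = (2^-1)%:E.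
Hypothesis ind : mutually_independent P
  (fun j : int + int => match j with inl x => F x | inr i => B i end).

Notation tail := (upper_tail c rho).

Lemma density_integral : (\int[lebesgue_measure]_x (rho x)%:E = 1)%E.
Proof. by rewrite -(lawF 0) ?preimage_setT ?probability_setT. Qed.

Definition law (A : set R) : R := fine (\int[lebesgue_measure]_(y in A) (rho y)%:E)%E.

Lemma lawE x A : measurable A -> P (F x @^-1` A) = (law A)%:E.
Proof.
by move=> mA; rewrite lawF// /law fineK//; apply: (density_fin rhoc rho_gt0 rho_out density_integral).
Qed.

Lemma law_ge0 A : 0 <= law A.
Proof.
apply: fine_ge0; apply: integral_ge0 => x _; rewrite lee_fin.
exact: (density_ge0 rho_gt0 rho_out).
Qed.

Lemma measurable_preimage (X : T -> R) (A : set R) : measurable_fun setT X -> measurable A ->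
  measurable (X @^-1` A).
Proof. by move=> mX mA; rewrite -[X in measurable X]setTI; exact: mX. Qed.

Lemma indF (s : seq int) (A : int -> set R) : uniq s -> (forall x, measurable (A x)) ->
  P [set w | forall x, x \in s -> A x (F x w)] = (\prod_(x <- s) law (A x))%:E.
Proof.
move=> us mA.
have := ind (s := map inl s) (A := fun j => if j is inl x then A x else setT).
rewrite map_inj_uniq; last by move=> x y [].
move=> /(_ us) h.
rewrite (_ : [set _ | _] = \bigcap_(j in [set` map inl s])
   ((match j with inl x => F x | inr i => B i end) @^-1`
     (if j is inl x then A x else setT))); last first.
  apply/seteqP; split => w /= hw.
    by move=> j /= /mapP[x xs ->]; exact: hw.
  by move=> x xs; apply: (hw (inl x)); rewrite /= map_f.
rewrite h; last by case.
rewrite big_map -prodEFin; apply: eq_bigr => x _; exact: lawE.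
Qed.

Lemma indB (i j : int) : i != j ->
  P (B i @^-1` [set 1] `&` B j @^-1` [set 1]) = ((2^-1 : R) ^+ 2)%:E.
Proof.
move=> ij.
have := ind (s := [:: inr i; inr j]) (A := fun=> [set 1]).
rewrite /= inE andbT (_ : inr i == inr j = (i == j))// ij => /(_ isT (fun _ => measurable_set1 _)).
rewrite big_cons big_seq1 !B1 -EFinM -expr2 => <-.
congr (P _); apply/seteqP; split => w /=.
  by move=> [h1 h2] k /=; rewrite !inE => /orP[] /eqP ->.
move=> h; split; first by apply: (h (inr i)); rewrite /= inE eqxx.
by apply: (h (inr j)); rewrite /= !inE eqxx orbT.
Qed.

Lemma small_out : small P 0 [set w | ~ ((forall x, `|F x w| < c) /\
   (forall i, B i w = 1 \/ B i w = -1))].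
Proof.
have mabs : measurable (~` `]-c, c[%classic : set R) by exact: measurableC.
have aeF x : {ae P, forall w, `|F x w| < c}.
  exists (F x @^-1` (~` `]-c, c[%classic)); split.
  - exact: measurable_preimage.
  - rewrite lawF// (eq_integral (fun=> 0%E)) ?integral0// => y; rewrite inE /= in_itv/= => h.
    by rewrite rho_out// leNgt ltr_norml; exact/negP.
  - by move=> w /= h; rewrite in_itv/= -ltr_norml.
have aeB i : {ae P, forall w, B i w = 1 \/ B i w = -1}.
  have m1 : measurable (B i @^-1` [set 1]) by exact: measurable_preimage.
  have m2 : measurable (B i @^-1` [set -1]) by exact: measurable_preimage.
  exists (~` (B i @^-1` [set 1] `|` B i @^-1` [set -1])); split.
  - by apply: measurableC; exact: measurableU.
  - rewrite probability_setC; last exact: measurableU.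
    rewrite measureU//; last first.
      by apply/seteqP; split => w //= [-> /eqP]; rewrite -subr_eq0 opprK (pnatr_eq0 R 2).
    have e : (P (B i @^-1` [set 1%R]) + P (B i @^-1` [set (- 1)%R]) = 1)%E.
      by rewrite B1 BN1 -EFinD; congr (_%:E); lra.
    by rewrite [X in (1 - X)%E](_ : _ = 1%E) ?subee.
  - by move=> w /= h [h1|h1]; apply: h; [left|right].
have aeFF : {ae P, forall w, forall n : nat,
    if @unpickle int n is Some x then `|F x w| < c else true}.
  apply: ae_foralln => n; case: unpickle => [x|]; first exact: aeF.
  by apply: aeW.
have aeBB : {ae P, forall w, forall n : nat,
    if @unpickle int n is Some x then B x w = 1 \/ B x w = -1 else True}.
  apply: ae_foralln => n; case: unpickle => [x|]; first exact: aeB.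
  by apply: aeW.
have := smallU (small_ae aeFF) (small_ae aeBB); rewrite addr0; apply: small_sub.
move=> w /=; rewrite not_andP => -[h|h]; [left|right] => h2; apply: h => x.
  by have := h2 (pickle x); rewrite pickleK.
by have := h2 (pickle x); rewrite pickleK.
Qed.

Lemma measurable_norm_gt (t : R) : measurable [set y : R | c - t < `|y|].
Proof.
rewrite (_ : [set _ | _] = (fun y : R => `|y|) @^-1` `]c - t, +oo[).
  by rewrite -[X in measurable X]setTI; apply: normr_measurable.
by apply/seteqP; split => y /=; rewrite in_itv/= andbT.
Qed.

Lemma law_high_le (t : R) : law [set y | c - t < `|y|] <= 2 * tail t.
Proof.
have mm : measurable [set y : R | c - t < `|y|] := measurable_norm_gt t.
rewrite -lee_fin -(lawE 0)// mulr_natl mulr2n.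
have -> : tail t = law `]c - t, +oo[%classic by [].
have e : law `]c - t, +oo[%classic = law `]-oo, (- (c - t))%R[%classic.
  by rewrite /law (density_tailN rhoN rhoc rho_gt0 rho_out).
rewrite EFinD {2}e -!(lawE 0)//.
apply: (@le_trans _ _ (P (F 0 @^-1` `]c - t, +oo[%classic `|` F 0 @^-1` `]-oo, (- (c - t))%R[%classic))).
  apply: le_measure; rewrite ?inE; try exact: measurable_preimage.
    by apply: measurableU; exact: measurable_preimage.
  move=> w /=; rewrite !in_itv/= andbT; case: (ger0P (F 0 w)) => h h2; [by left|right].
  by rewrite ltrNr.
by apply: measureU2; exact: measurable_preimage.
Qed.

(** Union bound over [x] and the offsets y - x, z - x. Triples with coinciding entries get the empty
    event, so independence is invoked only for distinct sites. *)
Lemma small_triple (t : R) (r w : nat) :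
  small P (((2 * r).+1 * ((2 * w).+1 * (2 * w).+1))%:R * (2 * tail t) ^+ 3)
    [set u | ~ forall x y z : int, `|x| <= r%:Z -> `|y - x| <= w%:Z -> `|z - x| <= w%:Z ->
      c - t < `|F x u| -> c - t < `|F y u| -> c - t < `|F z u| -> [\/ x = y, x = z | y = z]].
Proof.
pose I : finType := ('I_(2 * r).+1 * ('I_(2 * w).+1 * 'I_(2 * w).+1))%type.
pose X (p : I) : int := p.1%:Z - r%:Z.
pose Y (p : I) : int := X p + (p.2.1%:Z - w%:Z).
pose Z (p : I) : int := X p + (p.2.2%:Z - w%:Z).
pose A (p : I) : set T := if uniq [:: X p; Y p; Z p]
  then [set u | forall x, x \in [:: X p; Y p; Z p] -> c - t < `|F x u|] else set0.
have sA p : p \in enum I -> small P ((2 * tail t) ^+ 3) (A p).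
  move=> _; rewrite /A; case: ifPn => us; last first.
    exists set0; split => //; rewrite measure0 lee_fin exprn_ge0// mulr_ge0//.
    exact: law_ge0.
  exists [set u | forall x, x \in [:: X p; Y p; Z p] -> [set y | c - t < `|y|] (F x u)].
  split => //.
  - rewrite (_ : [set _ | _] = \bigcap_(x in [set` [:: X p; Y p; Z p]])
       (F x @^-1` [set y | c - t < `|y|])); last first.
      by apply/seteqP; split => u h x /h.
    rewrite bigcap_seq; apply: bigsetI_measurable => x _.
    by apply: measurable_preimage => //; exact: measurable_norm_gt.
  - rewrite (indF (A := fun=> [set y | c - t < `|y|]))//; last first.
      by move=> _; exact: measurable_norm_gt.
    rewrite !big_cons big_nil mulr1 lee_fin -expr2 -exprS.
    by rewrite lerXn2r// ?nnegrE ?law_high_le ?law_ge0// mulr_ge0// law_ge0.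
have := small_big sA; rewrite -cardE !card_prod !card_ord; apply: small_sub => u /=.
move=> /existsNP[x /existsNP[y /existsNP[z]]].
move=> /not_implyP[xr /not_implyP[yx /not_implyP[zx /not_implyP[hx /not_implyP[hy /not_implyP[hz hn]]]]]].
have b1 : (`|(x + r%:Z)%R| < (2 * r).+1)%N by lia.
have b2 : (`|(y - x + w%:Z)%R| < (2 * w).+1)%N by lia.
have b3 : (`|(z - x + w%:Z)%R| < (2 * w).+1)%N by lia.
exists (Ordinal b1, (Ordinal b2, Ordinal b3)); first by rewrite mem_enum.
have eX : X (Ordinal b1, (Ordinal b2, Ordinal b3)) = x by rewrite /X /=; lia.
have eY : Y (Ordinal b1, (Ordinal b2, Ordinal b3)) = y by rewrite /Y eX /=; lia.
have eZ : Z (Ordinal b1, (Ordinal b2, Ordinal b3)) = z by rewrite /Z eX /=; lia.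
rewrite /A eX eY eZ.
have us : uniq [:: x; y; z].
  rewrite /= !inE andbT negb_or; apply/andP; split; first apply/andP; first split.
  - by apply/eqP => e; apply: hn; constructor 1.
  - by apply/eqP => e; apply: hn; constructor 2.
  - by apply/eqP => e; apply: hn; constructor 3.
by rewrite us => v; rewrite !inE => /or3P[] /eqP ->.
Qed.

Lemma small_edge (t : R) (r : nat) :
  small P (((2 * r).+1)%:R * (2 * tail t) ^+ 2)
    [set u | exists2 x : int, `|x| <= r%:Z & c - t < `|F x u| /\ c - t < `|F (x + 1) u|].
Proof.
pose I : finType := 'I_(2 * r).+1.
pose X (p : I) : int := p%:Z - r%:Z.
have sA p : p \in enum I -> small P ((2 * tail t) ^+ 2)
    [set u | forall x, x \in [:: X p; X p + 1] -> [set y | c - t < `|y|] (F x u)].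
  move=> _; exists [set u | forall x, x \in [:: X p; X p + 1] -> [set y | c - t < `|y|] (F x u)].
  split => //.
  - rewrite (_ : [set _ | _] = \bigcap_(x in [set` [:: X p; X p + 1]])
       (F x @^-1` [set y | c - t < `|y|])); last first.
      by apply/seteqP; split => u h x /h.
    rewrite bigcap_seq; apply: bigsetI_measurable => x _.
    by apply: measurable_preimage => //; exact: measurable_norm_gt.
  - rewrite (indF (A := fun=> [set y | c - t < `|y|]))//; last 2 first.
      by rewrite /= inE andbT; lia.
      by move=> _; exact: measurable_norm_gt.
    rewrite !big_cons big_nil mulr1 lee_fin -expr2.
    by rewrite lerXn2r// ?nnegrE ?law_high_le ?law_ge0// mulr_ge0// law_ge0.
have := small_big sA; rewrite -cardE card_ord; apply: small_sub => u [x xr [h1 h2]].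
have b1 : (`|(x + r%:Z)%R| < (2 * r).+1)%N by lia.
exists (Ordinal b1); first by rewrite mem_enum.
have eX : X (Ordinal b1) = x by rewrite /X /=; lia.
by move=> y; rewrite eX !inE => /orP[] /eqP ->.
Qed.

(** The pairs {2j, 2j+1} are disjoint, hence independent, and each is good with probability
    [tail t ^+ 2]. The opposite signs make the gap smaller than 2 t. If no pair is good, the count
    is 0, below half its mean. *)
Lemma small_no_edge (t : R) (m : nat) : 0 < t -> (0 < m)%N ->
  small P (4 / (m%:R * (tail t) ^+ 2))
    [set u | ~ exists2 x : nat, (x < 2 * m)%N & c - t < F x%:Z u /\ F (x%:Z + 1) u < - (c - t)].
Proof.
move=> t0 m0.
have tp : 0 < tail t by exact: (tail_gt0 c0 rhoc rho_gt0 rho_out density_integral).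
pose A (x : int) : set R := if (2 %| x)%Z then `]c - t, +oo[%classic else `]-oo, (- (c - t))%R[%classic.
have mA x : measurable (A x) by rewrite /A; case: ifP.
have lA x : law (A x) = tail t.
  rewrite /A; case: ifP => _ //.
  by rewrite /law (density_tailN rhoN rhoc rho_gt0 rho_out).
pose S (j : nat) : seq int := [:: (2 * j)%:Z; (2 * j)%:Z + 1].
pose E (j : nat) : set T := [set u | forall x, x \in S j -> A x (F x u)].
have mE j : measurable (E j).
  rewrite (_ : E j = \bigcap_(x in [set` S j]) (F x @^-1` A x)); last first.
    by apply/seteqP; split => u h x /h.
  by rewrite bigcap_seq; apply: bigsetI_measurable => x _; exact: measurable_preimage.
have PE j : P (E j) = (tail t ^+ 2)%:E.
  rewrite indF//; last by rewrite /= inE andbT; lia.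
  by rewrite !big_cons big_nil !lA mulr1 -expr2.
have PEE i j : i != j -> P (E i `&` E j) = ((tail t ^+ 2) ^+ 2)%:E.
  move=> ij.
  rewrite (_ : E i `&` E j = [set u | forall x, x \in S i ++ S j -> A x (F x u)]); last first.
    apply/seteqP; split => u.
      by move=> [h1 h2] x; rewrite mem_cat => /orP[/h1|/h2].
    by move=> h; split => x xs; apply: h; rewrite mem_cat xs ?orbT.
  rewrite indF//; last by rewrite /S /= !inE; lia.
  by rewrite !big_cons big_nil !lA; congr (_%:E); ring.
apply: small_sub (small_chebyshev (m := m) mE PE PEE _); last first.
  by rewrite mulr_gt0 ?exprn_gt0 ?ltr0n.
move=> u /= h; rewrite big1 ?divr_ge0 ?mulr_ge0 ?exprn_ge0 ?(ltW tp)//.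
move=> j _; rewrite indicE memNset// => Ej; apply: h.
exists (2 * j)%N; first by rewrite ltn_mul2l /=.
have := Ej (2 * j)%:Z; have := Ej ((2 * j)%:Z + 1).
rewrite /A !inE !eqxx !orbT /= => /(_ isT) + /(_ isT).
have -> : (2 %| (2 * j)%:Z)%Z by rewrite PoszM dvdz_mulr.
have -> : (2 %| (2 * j)%:Z + 1)%Z = false by lia.
by rewrite /= !in_itv/= andbT => ? ?; split.
Qed.

Definition low_law := law [set y | `|y| <= c / 2].

Lemma measurable_norm_le : measurable [set y : R | `|y| <= c / 2].
Proof.
rewrite (_ : [set _ | _] = (fun y : R => `|y|) @^-1` `]-oo, c / 2]).
  by rewrite -[X in measurable X]setTI; apply: normr_measurable.
by apply/seteqP; split => y /=; rewrite in_itv.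
Qed.

Lemma low_law_gt0 : 0 < low_law.
Proof.
have c1 := c0.
have mm := measurable_norm_le.
rewrite -lte_fin /low_law /law fineK; last first.
  exact: (density_fin rhoc rho_gt0 rho_out density_integral).
apply: (@lt_le_trans _ _ (\int[lebesgue_measure]_(x in `]0%R, (c / 2)%R[) (rho x)%:E)%E).
  by apply: (density_itv_gt0 c0 rhoc rho_gt0 rho_out); lra.
apply: ge0_subset_integral => //.
- exact: (mEdensity rhoc rho_out).
- by move=> x _; rewrite lee_fin (density_ge0 rho_gt0 rho_out).
- by move=> x /=; rewrite in_itv/= => /andP[? ?]; rewrite gtr0_norm// ltW.
Qed.

Lemma small_few_low (r : nat) (e : int) : e = 1 \/ e = -1 -> (0 < r)%N ->
  small P (4 / (r%:R * low_law))
    [set u | \sum_(0 <= x < r) (`|F (e * x.+1%:Z) u| <= c / 2)%R%:R <= r%:R * low_law / 2 :> R].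
Proof.
move=> he r0.
pose E (j : nat) : set T := F (e * j.+1%:Z) @^-1` [set y | `|y| <= c / 2].
have mm := measurable_norm_le.
have mE j : measurable (E j) by exact: measurable_preimage.
have PE j : P (E j) = low_law%:E by exact: lawE.
have PEE i j : i != j -> P (E i `&` E j) = (low_law ^+ 2)%:E.
  move=> ij; pose S := [:: e * i.+1%:Z; e * j.+1%:Z].
  rewrite (_ : E i `&` E j = [set u | forall x, x \in S -> [set y | `|y| <= c / 2] (F x u)]); last first.
    apply/seteqP; split => u.
      by move=> [h1 h2] x; rewrite !inE => /orP[] /eqP ->.
    by move=> h; split; apply: h; rewrite !inE eqxx ?orbT.
  rewrite (indF (A := fun=> [set y | `|y| <= c / 2]))//; last first.
    by rewrite /= inE andbT; case: he => ->; lia.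
  by rewrite !big_cons big_nil mulr1 -expr2.
apply: small_sub (small_chebyshev (m := r) mE PE PEE _); last first.
  by rewrite mulr_gt0 ?low_law_gt0 ?ltr0n.
move=> u /=; rewrite big_mkord => h; apply: le_trans h.
apply: ler_sum => j _; rewrite indicE ler_nat.
by case: (boolP (u \in E j)) => // /set_mem /= ->.
Qed.

(** A block sum is 2 N - w, with N the number of plus signs. The sum of (N - w/2)^2 over blocks has
    mean at most J w / 2, so Markov at level 50 J w gives 1/100, and multiplying by 4 gives the
    threshold 200. *)
Lemma small_blocks (w J : nat) : (0 < w)%N -> (0 < J)%N ->
  small P (1 / 100) [set u | (forall i, B i u = 1 \/ B i u = -1) /\
    ~ \sum_(0 <= j < J) bsum (B^~ u) (j * w) (j.+1 * w) ^+ 2 <= 200 * (J * w)%:R].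
Proof.
move=> w0 J0.
pose E (j : nat) (i : nat) : set T := B (j * w + i).+1%:Z @^-1` [set 1].
have mE j i : measurable (E j i) by exact: measurable_preimage.
have PE j i : P (E j i) = (2^-1)%:E by exact: B1.
have PEE j i k : i != k -> P (E j i `&` E j k) = ((2^-1 : R) ^+ 2)%:E.
  by move=> ik; apply: indB; lia.
pose g (j : nat) u : R := (\sum_(i < w) \1_(E j i) u - w%:R * 2^-1) ^+ 2.
have mg j : measurable_fun setT (g j).
  apply: measurable_funX; apply: measurable_funB => //.
  by apply: measurable_sum => i; exact: measurable_indic.
have g0 j u : 0 <= g j u by exact: sqr_ge0.
pose f u : R := \sum_(0 <= j < J) g j u.
have If : (\int[P]_u (f u)%:E <= (J%:R * (w%:R * 2^-1))%:E)%E.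
  under eq_integral do rewrite -sumEFin.
  rewrite ge0_integral_sum//; last 2 first.
  - by move=> j; apply/measurable_EFinP.
  - by move=> j u _; rewrite lee_fin.
  rewrite mulr_natl -{2}(subn0 J) -sumr_const_nat -sumEFin.
  apply: lee_sum => j _; exact: (integral_sqr_indic w (mE j) (PE j) (PEE j)).
have a0 : 0 < 50 * (J * w)%:R :> R by rewrite mulr_gt0// ltr0n muln_gt0 J0.
have mf : measurable_fun setT f by apply: measurable_sum => j.
have f0 u : 0 <= f u by apply: sumr_ge0.
have Jw : (J%:R * w%:R : R) != 0 by rewrite mulf_neq0// pnatr_eq0 -lt0n.
have := small_markov a0 mf f0 If.
have -> : J%:R * (w%:R * 2^-1) / (50 * (J * w)%:R) = 1 / 100 :> R.
  by rewrite natrM; field; move: Jw; rewrite mulf_eq0 negb_or => /andP[-> ->].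
apply: small_sub => u /= [hB /negP]; rewrite -ltNge => h.
suff e : \sum_(0 <= j < J) bsum (B^~ u) (j * w) (j.+1 * w) ^+ 2 = 4 * f u.
  by rewrite e in h; lra.
rewrite /f mulr_sumr; apply: eq_bigr => j _; rewrite /g.
have -> : bsum (B^~ u) (j * w) (j.+1 * w) = \sum_(i < w) (2 * \1_(E j i) u - 1).
  rewrite /bsum mulSn addnC -{1}[(j * w)%N]add0n big_addn addKn big_mkord.
  apply: eq_bigr => i _; rewrite addnC indicE /E.
  case: (hB (j * w + i).+1%:Z) => e.
    by rewrite mem_set// mulr1 e; lra.
  rewrite memNset ?mulr0 ?e; first by lra.
  by rewrite /= e => /eqP; rewrite eq_sym -subr_eq0 opprK (pnatr_eq0 R 2).
rewrite sumrB sumr_const card_ord -mulr_sumr.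
set N := \sum_(i < w) _; rewrite -[X in _ - X]/(w%:R : R).
by field.
Qed.

(** Continuity from above, since F puts no mass on [c, +oo). *)
Lemma tail_small (e : R) : 0 < e -> exists2 t, 0 < t & tail t <= e.
Proof.
move=> e0.
pose C (n : nat) := F 0 @^-1` `]c - n.+1%:R^-1, +oo[%classic.
have mC n : measurable (C n) by exact: measurable_preimage.
have cv : P \o C @ \oo --> P (\bigcap_n C n).
  apply: nonincreasing_cvg_mu => //.
  - by apply: (@le_lt_trans _ _ 1%E); [exact: probability_le1|exact: ltry].
  - exact: bigcap_measurableType.
  - move=> m n mn; apply/subsetPset => w /=; rewrite /C /= !in_itv/= !andbT.
    by apply: le_lt_trans; rewrite lerD2l lerN2 lef_pV2 ?posrE ?ltr0n// ler_nat.
have CC : P (\bigcap_n C n) = 0%E.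
  apply/eqP; rewrite eq_le measure_ge0 andbT.
  have <- : P (F 0 @^-1` `[c, +oo[%classic) = 0%E.
    rewrite lawF// (eq_integral (fun=> 0%E)) ?integral0// => x; rewrite inE /= in_itv/= andbT => h.
    by rewrite rho_out//; have c1 := c0; rewrite ger0_norm; lra.
  apply: le_measure; rewrite ?inE//; first exact: bigcap_measurableType.
    exact: measurable_preimage.
  move=> w Cw; rewrite /= in_itv/= andbT leNgt; apply/negP => Fc.
  have [n] := ltr_add_invr Fc.
  rewrite -ltrBrDr => h; have := Cw n I; rewrite /C /= in_itv/= andbT.
  by move=> h2; have := lt_trans h h2; rewrite ltxx.
rewrite CC in cv.
have [N _ HN] : \forall n \near \oo, (P (C n) < e%:E)%E.
  apply: (cv [set x | (x < e%:E)%E]); apply: open_nbhs_nbhs; split; first exact: open_ereal_lt_ereal.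
  by rewrite /= lte_fin.
exists N.+1%:R^-1; first by rewrite invr_gt0.
by have := HN N (leqnn _); rewrite /= /C lawE// lte_fin => /ltW.
Qed.

End Environment.

(** * The comparison holds with large probability *)

Section TypicalComparison.
Context d (T : measurableType d) (R : realType) (P : probability T R).
Variables (c q kappa : R) (rho : R -> R) (F B : int -> T -> R).
Hypothesis c0 : 0 < c.
Hypothesis q0 : 0 < q.
Hypothesis rho_edge : (fun x => rho x / (`|c - x| `^ kappa)) x @[x --> c^'-] --> q.
Hypothesis rhoN : forall x, rho (- x) = rho x.
Hypothesis rhoc : {within `]-c, c[, continuous rho}.
Hypothesis rho_gt0 : forall x, - c < x < c -> 0 < rho x.
Hypothesis rho_out : forall x, c <= `|x| -> rho x = 0.
Hypothesis mF : forall x, measurable_fun setT (F x).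
Hypothesis mB : forall i, measurable_fun setT (B i).
Hypothesis lawF : forall x (A : set R), measurable A ->
  P (F x @^-1` A) = (\int[lebesgue_measure]_(y in A) (rho y)%:E)%E.
Hypothesis B1 : forall i, P (B i @^-1` [set 1]) = (2^-1)%:E.
Hypothesis BN1 : forall i, P (B i @^-1` [set -1]) = (2^-1)%:E.
Hypothesis ind : mutually_independent P
  (fun j : int + int => match j with inl x => F x | inr i => B i end).

Notation tail := (upper_tail c rho).

Let rho1 := density_integral lawF.

Lemma tail_doubling_iter : exists t0 D : R, [/\ 0 < t0, 1 <= D &
  forall k t, 0 < t -> 2 ^+ k * t <= t0 -> tail (2 ^+ k * t) <= D ^+ k * tail t].
Proof.
have [t0 [D [t00 D0 H]]] := tail_doubling c0 q0 rhoc rho_gt0 rho_out rho_edge rho1.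
exists t0, (Num.max 1 D); split => //; first by rewrite le_max lexx.
have D1 : D <= Num.max 1 D by rewrite le_max lexx orbT.
have D2 : 0 <= Num.max 1 D by rewrite le_max ler01.
elim=> [|k IH] t tp; first by rewrite !expr0 !mul1r.
rewrite !exprS -!mulrA => h.
have kp : 0 < 2 ^+ k * t by rewrite mulr_gt0// exprn_gt0.
have tg s : 0 < s -> 0 <= tail s.
  by move=> sp; apply/ltW; exact: (tail_gt0 c0 rhoc rho_gt0 rho_out rho1).
have kt : 2 ^+ k * t <= t0 by lra.
apply: le_trans (H _ _) _; first by rewrite kp.
by apply: ler_pM; rewrite ?(ltW D0)// ?tg//; exact: IH.
Qed.

(** Quantified over every minimizer [g] and every argmin [l], so that it is an event of the
    environment alone, independent of how these are selected. *)
Definition comparison (u : T) (C1 D0 delta theta r : R) (n v J rho' : nat) :=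
  [/\ forall x, `|F x u| < c, forall i, B i u = 1 \/ B i u = -1 &
  forall g l, free_minimizer (B^~ u) (F^~ u) n g -> is_ell c (F^~ u) n g l ->
  [/\ dgap c (F^~ u) l < D0 * theta, delta * r < `|l|%N%:R, (`|l| <= rho')%N &
    forall m0 m1, (tau n g l < m1 <= m0)%N -> (`|l| <= m0)%N -> (m0 + v * v <= n)%N ->
      cost c (B^~ u) (F^~ u) m1 l <= cost c (B^~ u) (F^~ u) m0 l + 1 + 2 * c +
        dgap c (F^~ u) l * (m1%:R + (v * v)%:R + 101 * (J * v)%:R)]].

(** Five events of probability at most 1/20, one of at most 1/100 and a null event; their total is
    below 3/10. *)
Lemma whp_comparison : exists C1 D0 delta : R, [/\ 0 < C1, 0 < D0, 0 < delta &
  forall (v : nat) (L : R), (202 <= v)%N -> 1 <= L ->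
  exists (theta r : R) (J rho' : nat), let n := (J * (v * v))%N in
    [/\ [/\ 0 < theta, L * theta <= 1, L <= r & rho'%:R <= C1 * r + 1],
     r < theta * n%:R <= 2 * r &
     small P (3 / 10) [set u | ~ comparison u C1 D0 delta theta r n v J rho']]].
Proof.
have tg t : 0 < t -> 0 < tail t by exact: (tail_gt0 c0 rhoc rho_gt0 rho_out rho1).
have tl s t : s <= t -> tail s <= tail t by exact: (tail_le rhoc rho_gt0 rho_out rho1).
have [C0 [C1 [D0 [delta [C10 D00 delta0 H]]]]] := scale_choice c0
  (low_law_gt0 c0 rhoc rho_gt0 rho_out lawF) tg tl
  (fun e e0 => tail_small c0 rhoc rho_gt0 rho_out mF lawF e0) tail_doubling_iter.
exists C1, D0, delta; split => // v L v202 L1.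
have v0 : (0 < v)%N by exact: leq_trans v202.
have w0 : (0 < v * v)%N by rewrite muln_gt0 v0.
have [theta [r [K [J [rho' [m [k]]]]]]] := H _ _ w0 L1.
move=> /= [[th0 Lth Lr rhi nr] [sm mn mQ] [slow Qlow] [EQ wEK EK Kc sT] [sN kd]].
exists theta, r, J.+1, rho'.+1; split => //.
have sU := small_le sm (small_no_edge c0 rhoN rhoc rho_gt0 rho_out mF lawF ind th0 (ltn0Sn m)).
have sT' := small_le sT (small_triple c0 rhoN rhoc rho_gt0 rho_out mF lawF ind K rho'.+1 (v * v)).
have sN' := small_le sN (small_edge c0 rhoN rhoc rho_gt0 rho_out mF lawF ind (D0 * theta) k).
have few e he := small_le slow
  (small_few_low c0 rhoc rho_gt0 rho_out mF lawF ind (e := e) he (ltn0Sn rho')).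
have sL1 := few 1 (or_introl erefl).
have sL2 := few (-1) (or_intror erefl).
have sB := small_blocks c0 mB B1 ind w0 (ltn0Sn J).
have sO := small_out rho_out mF mB lawF B1 BN1.
have sA := smallU (smallU (smallU sU sT') (smallU sN' sL1)) (smallU (smallU sL2 sB) sO).
apply: small_sub (small_le _ sA); last by lra.
move=> u ncomp; apply: contrapT => good; apply: ncomp.
have gO : (forall x, `|F x u| < c) /\ (forall i, B i u = 1 \/ B i u = -1).
  by apply: contrapT => h; apply: good; right; right.
case: gO => hF hB; split => // g l gmin hl.
have gB : \sum_(0 <= j < J.+1) bsum (B^~ u) (j * (v * v)) (j.+1 * (v * v)) ^+ 2
    <= 200 * (J.+1 * (v * v))%:R :> R.
  by apply: contrapT => h; apply: good; right; left; right.
have glow (e : int) : e = 1 \/ e = -1 -> rho'.+1%:R * low_law c rho / 2 <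
    \sum_(0 <= x < rho'.+1) (`|F (e * x.+1%:Z) u| <= c / 2)%R%:R.
  move=> he; rewrite ltNge; apply/negP => h; apply: good.
  by case: he h => -> h; [left; right; right|right; left; left].
have gU : exists2 x : nat, (x < 2 * m.+1)%N & c - theta < F x%:Z u /\ F (x%:Z + 1) u < - (c - theta).
  by apply: contrapT => h; apply: good; left; left; left.
have gT : forall x y z : int, `|x| <= rho'.+1%:Z -> `|y - x| <= (v * v)%:Z -> `|z - x| <= (v * v)%:Z ->
      c - K < `|F x u| -> c - K < `|F y u| -> c - K < `|F z u| -> [\/ x = y, x = z | y = z].
  by apply: contrapT => h; apply: good; left; left; right.
have gN : ~ exists2 x : int, `|x| <= k%:Z & c - D0 * theta < `|F x u| /\ c - D0 * theta < `|F (x + 1) u|.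
  by move=> h; apply: good; left; right; left.
have c2 : 0 < c / 2 by have c1 := c0; lra.
apply: (@minimizer_comparison _ c (B^~ u) (F^~ u) hB hF (J.+1 * (v * v)) v J.+1 rho'.+1 g l
  (C0 * r) (D0 * theta) K (delta * r)) => //.
- have [x xm [h1 h2]] := gU; exists x.
    by apply: leq_trans mn; exact: ltnW.
  apply: le_trans mQ; apply: lerD.
    rewrite ler_wpM2l ?ler_nat; first by [].
      by have c1 := c0; lra.
    exact: ltnW.
  rewrite ler_wpM2r// /dgap; have := ler_norm (F x%:Z u - F (x%:Z + 1) u).
  by rewrite distrC; lra.
- move=> e he; apply: lt_trans Qlow _; rewrite ltr_pM2l//; exact: glow.
- by rewrite mulr_gt0.
- by move=> x xk [h1 h2]; apply: gN; exists x => //; rewrite -abszE lez_nat; exact: kd.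
Qed.

End TypicalComparison.

(** * The shape function *)

(* The walk needs a whole number of steps to cover [lam] at inverse speed [A];
   [m] is chosen so that rounding the position [m / A] returns [lam] exactly. *)
Lemma inverse_speed (R : realType) (A : R) (lam : nat) (m := (Num.truncn (A * lam%:R)).+1) :
  1 < A -> [/\ A * lam%:R < m%:R, m%:R <= A * lam%:R + 1, (lam <= m)%N &
    round0 (A^-1 * m%:R) = lam%:Z].
Proof.
move=> A1; have A0 : 0 < A by lra.
have x0 : 0 <= A * lam%:R by rewrite mulr_ge0// ltW.
have h1 := truncnS_gt (A * lam%:R).
have h2 := truncnS_le x0.
split => //.
  rewrite -(ler_nat R); apply: le_trans (ltW h1).
  by rewrite ler_peMl// ltW.
rewrite /round0 mulr_ge0 ?invr_ge0 ?(ltW A0)//.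
apply: floor_def; rewrite (_ : lam%:Z + 1 = lam.+1%:Z); last by lia.
rewrite -!pmulrn ler_pdivlMl// ltr_pdivrMl// (ltW h1)/=.
by apply: le_lt_trans h2 _; rewrite -natr1 mulrDr mulr1 ltrD2l.
Qed.

Lemma ex_upper_bound (R : realType) (s : seq R) : exists2 L : R, 1 <= L & forall x, x \in s -> x <= L.
Proof.
elim: s => [|y s [L L1 HL]]; first by exists 1.
exists (Num.max y L); first by rewrite le_max L1 orbT.
move=> x; rewrite inE => /orP[/eqP ->|/HL xL]; first by rewrite le_max lexx.
by rewrite le_max xL orbT.
Qed.

Lemma ler_norm_step (R : realType) (m x G : R) : x <= m -> m <= x + 1 ->
  `|m * G - x * G| <= `|G|.
Proof.
move=> xm mx; rewrite -mulrBl normrM ger0_norm ?subr_ge0//.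
by rewrite ler_piMl//; lra.
Qed.

Lemma cost_near (R : realType) (c : R) (b f : int -> R) (m : nat) (k : int) (L eta : R) :
  (0 < m)%N -> `|min_action b f m k / m%:R - - L| <= eta ->
  `|cost c b f m k - m%:R * (c - L)| <= eta * m%:R.
Proof.
move=> m0 h; have mR : 0 < m%:R :> R by rewrite ltr0n.
have -> : cost c b f m k - m%:R * (c - L) = (min_action b f m k / m%:R - - L) * m%:R.
  by rewrite /cost; field; rewrite gt_eqF.
by rewrite normrM (gtr0_norm mR) ler_pM2r.
Qed.

(** The [G]'s stand for c - Lambda at 1/M, alpha and 0, with [A] = 1/alpha, and the [X]'s for the
    costs of reaching ell at times [m1], [m0] and of returning to 0 at time [n]. In the notation of
    the overview [M * G1] is g(1/M) and [Ga * A] is g(alpha). Dividing the cost inequalities by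
    [lam], respectively [n], leaves errors that are fractions of [e]. *)
Lemma shape_arith (R : realType) (c M A C1 D0 delta e eta L r theta dg lam m1 m0 n Jv v w
    X1 X0 Xz G1 Ga Gz : R) :
  0 < c -> 1 < M -> M < A -> 0 < C1 -> 0 < D0 -> 0 < delta -> 0 < e -> 0 < eta ->
  eta * (8 * (M + A)) = e -> 808 * D0 <= e * delta * v ->
  8 * (`|G1| + `|Ga| + 1 + 2 * c + 2 * eta) <= L * delta * e ->
  8 * (D0 * (M + 1 + w)) <= L * e -> 8 * (D0 * (A + 1)) <= L * e ->
  8 * (4 * c * C1 + 6 * c + 1) <= L * e -> 8 <= L * e -> 8 * D0 <= L * e ->
  1 <= L -> 0 < theta -> L * theta <= 1 -> L <= r -> r < theta * n -> theta * n <= 2 * r ->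
  r * L < n -> dg < D0 * theta -> 0 <= dg -> delta * r < lam -> 1 <= lam -> lam <= C1 * r + 1 ->
  0 <= w -> 0 < v -> 0 <= Jv -> Jv * v = n ->
  M * lam < m1 -> m1 <= M * lam + 1 -> A * lam < m0 -> m0 <= A * lam + 1 ->
  `|X1 - m1 * G1| <= eta * m1 -> `|X0 - m0 * Ga| <= eta * m0 -> `|Xz - n * Gz| <= eta * n ->
  X1 <= X0 + 1 + 2 * c + dg * (m1 + w + 101 * Jv) ->
  X0 <= X1 + 1 + 2 * c + dg * m0 ->
  Xz <= 4 * c * lam + 2 * c + 1 + dg * n -> -1 <= Xz ->
  [/\ Gz <= e, - e <= Gz, Ga * A <= M * G1 + e & M * G1 <= Ga * A + e].
Proof.
move=> c0 M1 AM C10 D00 delta0 e0 eta0 etaE vlo LC LM LA LZ L8 LD L1 th0 Lth Lr nlo nhi nL dgE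
  dg0 dl lam1 lamrho w0 v0 Jv0 Jvn m1lo m1hi m0lo m0hi near1 near0 nearz cA cB cZ cN.
have st1 := ler_norm_step G1 (ltW m1lo) m1hi.
have st0 := ler_norm_step Ga (ltW m0lo) m0hi.
have L0 : 0 < L := lt_le_trans ltr01 L1.
have r1 : 1 <= r := le_trans L1 Lr.
have r0 : 0 < r := lt_le_trans ltr01 r1.
have lam0 : 0 < lam := lt_le_trans ltr01 lam1.
have n0 : 0 < n by apply: lt_trans nL; rewrite mulr_gt0.
have A0 : 0 < A by clear -M1 AM; lra.
have M0 : 0 < M by clear -M1; lra.
have le_theta (z : R) : 0 <= z -> z <= L * e -> theta * z <= e.
  move=> z0 zL; apply: (@le_trans _ _ (theta * (L * e))); first by rewrite ler_pM2l.
  by rewrite mulrA [theta * L]mulrC; apply: ler_piMl => //; exact: ltW.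
have tM : theta * (8 * (D0 * (M + 1 + w))) <= e.
  by apply: le_theta => //; rewrite !mulr_ge0 ?(ltW D00)//; clear -M0 w0; lra.
have tA : theta * (8 * (D0 * (A + 1))) <= e.
  by apply: le_theta => //; rewrite !mulr_ge0 ?(ltW D00)//; clear -A0; lra.
have tZ : theta * (8 * (4 * c * C1 + 6 * c + 1)) <= e.
  apply: le_theta => //; have := mulr_gt0 c0 C10; clear -c0; lra.
have tD : theta * (8 * D0) <= e by apply: le_theta => //; clear -D00; lra.
have lamC : 8 * (`|G1| + `|Ga| + 1 + 2 * c + 2 * eta) <= lam * e.
  apply: le_trans LC _; rewrite ler_pM2r//; apply: le_trans (ltW dl).
  by rewrite mulrC ler_pM2l.
(* The sign fluctuations: dg n <= 2 D0 r and delta r < lam, so the requirement is 808 = 4 * 2 * 101.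
   It is the one error controlled by [v] and not by [L]. *)
have edge : dg * (101 * Jv) <= e / 4 * lam.
  rewrite -(ler_pM2r v0).
  have -> : dg * (101 * Jv) * v = 101 * (dg * n) by rewrite -Jvn; ring.
  have h1 : dg * n <= D0 * (2 * r).
    apply: (@le_trans _ _ (D0 * theta * n)); first by rewrite ler_pM2r// ltW.
    by rewrite -mulrA ler_pM2l.
  have h2 : 808 * D0 * r <= e * delta * v * r by rewrite ler_pM2r.
  have h3 : e * v * (delta * r) <= e * v * lam by rewrite ler_pM2l ?mulr_gt0// ltW.
  clear -h1 h2 h3; lra.
have dgM : dg * (m1 + w) <= e / 8 * lam.
  apply: (@le_trans _ _ (D0 * theta * ((M + 1 + w) * lam))).
    apply: ler_pM => //; [|exact: ltW|].
      by rewrite addr_ge0//; apply: le_trans (ltW m1lo); rewrite mulr_ge0 ?ltW.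
    have : w <= w * lam by rewrite ler_peMr.
    by clear -m1hi lam1; lra.
  have : theta * (8 * (D0 * (M + 1 + w))) * lam <= e * lam by rewrite ler_pM2r.
  clear; lra.
have dgA : dg * m0 <= e / 8 * lam.
  apply: (@le_trans _ _ (D0 * theta * ((A + 1) * lam))).
    apply: ler_pM => //; [|exact: ltW|].
      by apply: le_trans (ltW m0lo); rewrite mulr_ge0 ?ltW.
    by clear -m0hi lam1; lra.
  have : theta * (8 * (D0 * (A + 1))) * lam <= e * lam by rewrite ler_pM2r.
  clear; lra.
have em : eta * m1 + eta * m0 <= e / 8 * lam + 2 * eta.
  have : eta * m1 <= eta * (M * lam + 1) by rewrite ler_pM2l.
  have : eta * m0 <= eta * (A * lam + 1) by rewrite ler_pM2l.
  rewrite -etaE; clear; lra.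
move: near1 near0 st1 st0; rewrite !ler_norml => /andP[a1 a2] /andP[b1 b2] /andP[d1 d2] /andP[f1 f2].
have mainA : lam * (M * G1) <= lam * (Ga * A + e).
  clear -a1 a2 b1 b2 d1 d2 f1 f2 cA em dgM edge lamC e0 lam0.
  have : 0 <= e * lam by rewrite mulr_ge0 ?ltW.
  rewrite mulrDr in cA; lra.
have mainB : lam * (Ga * A) <= lam * (M * G1 + e).
  clear -a1 a2 b1 b2 d1 d2 f1 f2 cB em dgA lamC e0 lam0.
  have : 0 <= e * lam by rewrite mulr_ge0 ?ltW.
  lra.
rewrite ler_pM2l// in mainA; rewrite ler_pM2l// in mainB.
have eta8 : eta <= e / 8.
  rewrite -etaE; have : eta * 1 <= eta * (M + A) by rewrite ler_pM2l//; clear -M1 A0; lra.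
  clear; lra.
move: nearz; rewrite ler_norml => /andP[z1 z2].
have n1 : 1 <= e / 8 * n.
  have : 8 * r <= L * e * r by rewrite ler_pM2r.
  have : e * (r * L) <= e * n by rewrite ler_pM2l// ltW.
  clear -r1; lra.
split => //.
- rewrite -(ler_pM2l n0).
  have h1 : dg * n <= e / 8 * n.
    rewrite ler_pM2r//; apply: le_trans (ltW dgE) _; clear -tD; lra.
  have h2 : 8 * (4 * c * lam + 2 * c + 1) <= e * n.
    apply: (@le_trans _ _ (8 * (4 * c * C1 + 6 * c + 1) * r)).
      have : c * lam <= c * (C1 * r + 1) by rewrite ler_pM2l.
      have : c <= c * r by rewrite ler_peMr// ltW.
      clear -r1; lra.
    have : 8 * (4 * c * C1 + 6 * c + 1) * r <= L * e * r by rewrite ler_pM2r.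
    have : e * (r * L) <= e * n by rewrite ler_pM2l// ltW.
    clear; lra.
  have h3 : eta * n <= e / 8 * n by rewrite ler_pM2r.
  have : 0 <= e * n by rewrite mulr_ge0 ?ltW.
  clear -z1 cZ h1 h2 h3; lra.
- rewrite -(ler_pM2l n0).
  have h3 : eta * n <= e / 8 * n by rewrite ler_pM2r.
  have : 0 <= e * n by rewrite mulr_ge0 ?ltW.
  clear -z2 cN h3 n1; lra.
Qed.

(** A countable union over the value k of ell and a time i with the walk in {k, k+1}. Such an i need
    not be [tau], but it bounds [tau] from above, which suffices for a strict upper bound. *)
Lemma measurable_hitting d (T : measurableType d) (R : realType) (c M : R)
    (F : int -> T -> R) (n : nat) (g : T -> nat -> int) (l : T -> int) :
  (forall w, is_ell c (F^~ w) n (g w) (l w)) ->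
  (forall i k, measurable [set w | g w i = k]) ->
  (forall k, measurable [set w | l w = k]) ->
  measurable [set w | (tau n (g w) (l w))%:R < M * (`|l w|%:~R) :> R].
Proof.
move=> hl mg ml.
pose S (p : int * nat) : set T := if (p.2%:R < M * `|p.1|%:~R :> R) && (p.2 <= n)%N then
  [set w | l w = p.1] `&` ([set w | g w p.2 = p.1] `|` [set w | g w p.2 = p.1 + 1]) else set0.
rewrite (_ : [set _ | _] = \bigcup_p S p).
  apply: countable_bigcupT_measurable; first exact: countableP.
  move=> p; rewrite /S; case: ifP => _; last exact: measurable0.
  by apply: measurableI => //; exact: measurableU.
apply/seteqP; split => w /=.
  move=> h; have [tn gt] := tauP (hl w).
  by exists (l w, tau n (g w) (l w)) => //; rewrite /S /= h tn; split.
move=> [[k i] _]; rewrite /S /=; case: ifP => // /andP[ik iN] [lk gi].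
apply: le_lt_trans (_ : i%:R < _); last by rewrite lk.
rewrite ler_nat leqNgt; apply/negP => it.
have := before_find 0%N it; rewrite nth_iota ?add0n// lk.
by case: gi => ->; rewrite eqxx ?orbT.
Qed.

Lemma small_cvg1 d (T : measurableType d) (R : realType) (P : probability T R)
    (A : nat -> set T) (e : R) : (forall n, measurable (A n)) ->
  (fun n => P (A n)) @ \oo --> 1%E -> 0 < e ->
  exists N, forall n, (N <= n)%N -> small P e (~` A n).
Proof.
move=> mA cv e0.
have [N _ HN] : \forall n \near \oo, ((1 - e)%:E < P (A n))%E.
  apply: (cv [set x | ((1 - e)%:E < x)%E]); apply: open_nbhs_nbhs; split; first exact: open_ereal_gt_ereal.
  by rewrite /= lte_fin; lra.
exists N => n Nn; exists (~` A n); split => //; first exact: measurableC.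
have := HN n Nn; rewrite probability_setC//= -(fineK (fin_num_measure P _ (mA n))) lte_fin => h.
by rewrite -EFinB lee_fin; lra.
Qed.

Unset Implicit Arguments.

Theorem theorem2p7
  (R : realType) (d : measure_display) (T : measurableType d)
  (P : probability T R)
  (c q kappa : R) (rho : R -> R)
  (F : int -> T -> R) (B : int -> T -> R)
  (Lambda : R -> R)
  (gbar : nat -> T -> nat -> int) (ell : nat -> T -> int)
  (M : R) :
  0 < c -> 0 < q -> -1 < kappa ->
  (* the density rho *)
  (forall x, rho (- x) = rho x) ->
  {within `]-c, c[, continuous rho} ->
  (forall x, - c < x < c -> 0 < rho x) ->
  (forall x, c <= `|x| -> rho x = 0) ->
  (fun x => rho x / (`|c - x| `^ kappa)) x @[x --> c^'-] --> q ->
  (* the random environment *)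
  (forall x, measurable_fun setT (F x)) ->
  (forall i, measurable_fun setT (B i)) ->
  (forall x (A : set R), measurable A ->
     P (F x @^-1` A) = (\int[lebesgue_measure]_(y in A) (rho y)%:E)%E) ->
  (forall i, P (B i @^-1` [set 1]) = (2^-1)%:E) ->
  (forall i, P (B i @^-1` [set -1]) = (2^-1)%:E) ->
  mutually_independent P
    (fun j : int + int => match j with inl x => F x | inr i => B i end) ->
  (* the shape function *)
  (forall alpha, -1 <= alpha <= 1 -> 0 <= Lambda alpha) ->
  (forall alpha, -1 <= alpha <= 1 ->
     {ae P, forall w, (fun n : nat =>
        min_action (fun i => B i w) (fun x => F x w) n (round0 (alpha * n%:R))
        / n%:R) @ \oo --> - Lambda alpha}) ->
  (* the free-endpoint minimizers gbar_n, ell_n (random variables) *)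
  (forall n w, free_minimizer (fun i => B i w) (fun x => F x w) n (gbar n w)) ->
  (forall n i k, measurable [set w | gbar n w i = k]) ->
  (forall n w, is_ell c (fun x => F x w) n (gbar n w) (ell n w)) ->
  (forall n k, measurable [set w | ell n w = k]) ->
  (* hypothesis of the theorem *)
  1 < M ->
  (fun n : nat => P [set w | (tau n (gbar n w) (ell n w))%:R < M * (`|ell n w|%:~R)])
     @ \oo --> 1%E ->
  (* conclusion: Lambda restricted to [0, 1/M] is linear (affine) *)
  exists a b : R, forall alpha, 0 <= alpha <= M^-1 -> Lambda alpha = a + b * alpha.
Proof.
move=> c0 q0 _ rhoN rhoc rho_gt0 rho_out rho_edge mF mB lawF B1 BN1 ind _ lim gmin mg hl ml M1 hyp.
have iM0 : 0 < M^-1 by rewrite invr_gt0; lra.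
have iM1 : M^-1 < 1 by rewrite invf_lt1//; lra.
have even alpha : 0 <= alpha <= 1 -> Lambda (- alpha) = Lambda alpha.
  move=> /andP[a0 a1].
  have := limit_reflect mF mB lawF ind (lim alpha _) (lim (- alpha) _).
  by move=> /(_ ltac:(lra) ltac:(lra)) /oppr_inj.
have [C1 [D0 [delta [C10 D00 delta0 whp]]]] := whp_comparison c0 q0 rho_edge rhoN rhoc rho_gt0 rho_out mF mB lawF B1 BN1 ind.
have [n0 hn0] := small_cvg1 (e := 20^-1) (fun n => measurable_hitting M (hl n) (mg n) (ml n)) hyp ltac:(lra).
pose G0 := M * (c - Lambda M^-1).
(* Five limits and the hypothesis on [tau] at 1/20 each, together with 3/10 for the comparison. *)
have lt1 : 20^-1 + 20^-1 + (20^-1 + 20^-1) + (20^-1 + (20^-1 + 3 / 10)) < 1 :> R by lra.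
have M0 : 0 < M by lra.
have iM01 : 0 <= M^-1 <= 1 by rewrite !ltW.
have main alpha : 0 < alpha < M^-1 -> forall e, 0 < e ->
    [/\ c - Lambda 0 <= e, - e <= c - Lambda 0, (c - Lambda alpha) / alpha <= G0 + e &
      G0 <= (c - Lambda alpha) / alpha + e].
  move=> /andP[a0 aM] e e0.
  set G1 := c - Lambda M^-1; set Ga := c - Lambda alpha; set Gz := c - Lambda 0.
  pose A := alpha^-1.
  have al01 : 0 <= alpha <= 1 by rewrite (ltW a0)/= ltW// (lt_trans aM).
  have AM : M < A by rewrite /A -(invrK M) ltf_pV2// posrE.
  have A1 : 1 < A := lt_trans M1 AM.
  have A0 : 0 < A := lt_trans M0 AM.
  pose eta := e / (8 * (M + A)).
  have MA0 : 0 < 8 * (M + A) by lra.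
  have eta0 : 0 < eta by rewrite /eta divr_gt0.
  have etaE : eta * (8 * (M + A)) = e by rewrite /eta divfK// gt_eqF.
  have limN beta : -1 <= beta <= 1 -> exists N : nat, small P 20^-1
      [set w | exists2 m, (N <= m)%N & eta < `|min_action (B^~ w) (F^~ w) m
         (round0 (beta * m%:R)) / m%:R - - Lambda beta|].
    move=> hb; apply: small_eventually_far (lim beta hb) eta0 _; last by rewrite invr_gt0 ltr0n.
    by move=> n; apply: measurable_funM => //; exact: measurable_min_action.
  (* Both signs of each speed are needed, since ell may lie on either side of the origin. *)
  have [N1 s1] := limN M^-1 ltac:(clear -iM01; lra).
  have [N2 s2] := limN (- M^-1) ltac:(clear -iM01; lra).
  have [N3 s3] := limN alpha ltac:(clear -al01; lra).
  have [N4 s4] := limN (- alpha) ltac:(clear -al01; lra).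
  have [N5 s5] := limN 0 ltac:(clear; lra).
  pose N := (N1 + N2 + N3 + N4 + N5)%N.
  (* Fixed by [e], [D0] and [delta] only, before [L] and [theta]. *)
  pose v := ((Num.truncn (808 * D0 / (e * delta))).+1 + 202)%N.
  have v202 : (202 <= v)%N by rewrite leq_addl.
  have ed0 : 0 < e * delta by rewrite mulr_gt0.
  have vlo : 808 * D0 <= e * delta * v%:R.
    have h := truncnS_gt (808 * D0 / (e * delta)).
    rewrite [leRHS]mulrC -ler_pdivrMr//; apply: le_trans (ltW h) _.
    by rewrite (ler_nat R) leq_addr.
  pose w := (v * v)%N.
  pose Cst : R := `|G1| + `|Ga| + 1 + 2 * c + 2 * eta.
  (* [L] will bound r and 1/theta from below. The list collects the thresholds: among others,
     [N / delta] makes |ell| reach [N], the entry with [C1 + 1] gives room for [m0 + v * v] within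
     [n], and [2 * C1 + 3] makes 2 |ell| less than [n]. *)
  have [L L1 HL] := ex_upper_bound [:: N%:R / delta; N%:R; n0%:R; 8 * Cst / e / delta;
    8 * (D0 * (M + 1 + w%:R)) / e; 8 * (D0 * (A + 1)) / e; 8 * (4 * c * C1 + 6 * c + 1) / e;
    8 / e; 8 * D0 / e; A * (C1 + 1) + 1 + w%:R; 2 * C1 + 3; delta^-1].
  have LN : N%:R <= L * delta by rewrite -ler_pdivrMr//; apply: HL; rewrite !inE eqxx ?orbT.
  have LN' : N%:R <= L by apply: HL; rewrite !inE eqxx ?orbT.
  have Ln0 : n0%:R <= L by apply: HL; rewrite !inE eqxx ?orbT.
  have LC : 8 * Cst <= L * delta * e.
    rewrite -ler_pdivrMr// -ler_pdivrMr//; apply: HL; rewrite !inE eqxx ?orbT//.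
  have LM : 8 * (D0 * (M + 1 + w%:R)) <= L * e by rewrite -ler_pdivrMr//; apply: HL; rewrite !inE eqxx ?orbT.
  have LA : 8 * (D0 * (A + 1)) <= L * e by rewrite -ler_pdivrMr//; apply: HL; rewrite !inE eqxx ?orbT.
  have LZ : 8 * (4 * c * C1 + 6 * c + 1) <= L * e by rewrite -ler_pdivrMr//; apply: HL; rewrite !inE eqxx ?orbT.
  have L8 : 8 <= L * e by rewrite -ler_pdivrMr//; apply: HL; rewrite !inE eqxx ?orbT.
  have LD : 8 * D0 <= L * e by rewrite -ler_pdivrMr//; apply: HL; rewrite !inE eqxx ?orbT.
  have LW : A * (C1 + 1) + 1 + w%:R <= L by apply: HL; rewrite !inE eqxx ?orbT.
  have LR : 2 * C1 + 3 <= L by apply: HL; rewrite !inE eqxx ?orbT.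
  have Ld : 1 <= L * delta by rewrite -ler_pdivrMr// mul1r; apply: HL; rewrite !inE eqxx ?orbT.
  have [theta [r [J [rho' [[th0 Lth Lr rhi] /andP[nlo nhi] sC]]]]] := whp v L v202 L1.
  set n := (J * (v * v))%N in nlo nhi sC.
  have L0 : 0 < L := lt_le_trans ltr01 L1.
  have r1 : 1 <= r := le_trans L1 Lr.
  have r0 : 0 < r := lt_le_trans ltr01 r1.
  have th1 : theta <= 1 by apply: le_trans Lth; rewrite ler_peMl// ltW.
  have nL : r * L < n%:R.
    have n0' : 0 <= n%:R :> R by rewrite ler0n.
    have : r * L < theta * n%:R * L by rewrite ltr_pM2r.
    move/lt_le_trans; apply; rewrite mulrAC [theta * L]mulrC; exact: ler_piMl.
  have nN : (n0 <= n)%N.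
    by rewrite -(ler_nat R); apply: le_trans Ln0 (ltW (le_lt_trans _ nL)); rewrite ler_peMl// ltW.
  have nN' : (N <= n)%N.
    by rewrite -(ler_nat R); apply: le_trans LN' (ltW (le_lt_trans _ nL)); rewrite ler_peMl// ltW.
  have sH := hn0 n nN.
  have [u good] := small_ex (smallU (smallU (smallU s1 s2) (smallU s3 s4)) (smallU s5 (smallU sH sC))) lt1.
  have cmp : comparison c F B u C1 D0 delta theta r n v J rho'.
    by apply: contrapT => h; apply: good; right; right; right.
  have tauM : (tau n (gbar n u) (ell n u))%:R < M * (`|ell n u|%:~R) :> R.
    by apply: contrapT => h; apply: good; right; right; left.
  case: cmp => hF hB /(_ _ _ (gmin n u) (hl n u))[dE dl lrho cmp].
  set l := ell n u in tauM dE dl lrho cmp.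
  have lim1 m : (N <= m)%N -> `|min_action (B^~ u) (F^~ u) m (round0 (M^-1 * m%:R)) / m%:R - - Lambda M^-1| <= eta.
    move=> Nm; rewrite leNgt; apply/negP => h; apply: good; left; left; left; exists m => //.
    by apply: leq_trans Nm; rewrite /N; clear; lia.
  have lim2 m : (N <= m)%N -> `|min_action (B^~ u) (F^~ u) m (round0 (- M^-1 * m%:R)) / m%:R - - Lambda M^-1| <= eta.
    move=> Nm; rewrite leNgt; apply/negP => h; apply: good; left; left; right; exists m => //.
      by apply: leq_trans Nm; rewrite /N; clear; lia.
    by rewrite even.
  have lim3 m : (N <= m)%N -> `|min_action (B^~ u) (F^~ u) m (round0 (alpha * m%:R)) / m%:R - - Lambda alpha| <= eta.
    move=> Nm; rewrite leNgt; apply/negP => h; apply: good; left; right; left; exists m => //.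
    by apply: leq_trans Nm; rewrite /N; clear; lia.
  have lim4 m : (N <= m)%N -> `|min_action (B^~ u) (F^~ u) m (round0 (- alpha * m%:R)) / m%:R - - Lambda alpha| <= eta.
    move=> Nm; rewrite leNgt; apply/negP => h; apply: good; left; right; right; exists m => //.
      by apply: leq_trans Nm; rewrite /N; clear; lia.
    by rewrite even.
  have lim5 : `|min_action (B^~ u) (F^~ u) n 0 / n%:R - - Lambda 0| <= eta.
    rewrite leNgt; apply/negP => h; apply: good; right; left; exists n => //.
      by apply: leq_trans nN'; rewrite /N; clear; lia.
    by rewrite mul0r /round0 lexx floor0.
  clear good s1 s2 s3 s4 s5 sH sC hyp whp limN lim.
  have lamN : (N <= `|l|)%N.
    rewrite -(ler_nat R); apply: le_trans LN _; apply: le_trans (ltW dl).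
    by rewrite mulrC ler_pM2l.
  (* The first integer times after M |ell| and A |ell|; in particular [tau < m1]. *)
  pose m1 := (Num.truncn (M * `|l|%N%:R)).+1.
  pose m0 := (Num.truncn (A * `|l|%N%:R)).+1.
  have [m1lo m1hi lm1 rd1] := inverse_speed `|l|%N M1.
  have [m0lo m0hi lm0 rd0] := inverse_speed `|l|%N A1.
  rewrite -/m1 in m1lo m1hi lm1 rd1; rewrite -/m0 /A invrK -/A in m0lo m0hi lm0 rd0.
  have lsgn : l = `|l|%N%:Z \/ l = - `|l|%N%:Z by clear; lia.
  have near1 : `|cost c (B^~ u) (F^~ u) m1 l - m1%:R * G1| <= eta * m1%:R.
    apply: cost_near => //; have Nm := leq_trans lamN lm1.
    case: lsgn => ->; first by rewrite -rd1; exact: lim1.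
    by rewrite -rd1 -round0N -mulNr; exact: lim2.
  have near0 : `|cost c (B^~ u) (F^~ u) m0 l - m0%:R * Ga| <= eta * m0%:R.
    apply: cost_near => //; have Nm := leq_trans lamN lm0.
    case: lsgn => ->; first by rewrite -rd0; exact: lim3.
    by rewrite -rd0 -round0N -mulNr; exact: lim4.
  have n0' : (0 < n)%N by rewrite -(ltr_nat R); apply: le_lt_trans nL; rewrite mulr_ge0// ltW.
  have nearz : `|cost c (B^~ u) (F^~ u) n 0 - n%:R * Gz| <= eta * n%:R.
    exact: cost_near.
  have m10 : (m1 <= m0)%N.
    by rewrite ltnS; apply: le_truncn; rewrite ler_wpM2r// ltW.
  have tm1 : (tau n (gbar n u) l < m1)%N.
    by rewrite -(ltr_nat R); apply: lt_trans m1lo; rewrite natr_absz.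
  have lamrho : `|l|%N%:R <= C1 * r + 1 :> R by apply: le_trans rhi; rewrite ler_nat.
  have m0n : (m0 + v * v <= n)%N.
    rewrite -(ler_nat R) natrD; apply: le_trans (ltW nL).
    have : A * `|l|%N%:R <= A * (C1 * r + 1) by rewrite ler_pM2l.
    have : r * (A * (C1 + 1) + 1 + w%:R) <= r * L by rewrite ler_pM2l.
    have : A <= r * A by rewrite ler_peMl// ltW.
    have : w%:R <= r * w%:R by rewrite ler_peMl.
    by move: m0hi r1; clear; rewrite -/w; lra.
  have cA := cmp m0 m1 ltac:(by rewrite tm1 m10) lm0 m0n.
  have lam1 : 1 <= `|l|%N%:R :> R.
    apply: le_trans Ld (le_trans _ (ltW dl)); by rewrite mulrC ler_pM2l.
  have lz2 : (2 * `|l| < n)%N.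
    rewrite -(ltr_nat R) natrM; apply: le_lt_trans nL.
    have : r * (2 * C1 + 3) <= r * L by rewrite ler_pM2l.
    by move: lamrho r1; clear; lra.
  have cZ := cost_zero_le hB hF lz2.
  (* The converse comparison: arrive at the higher speed 1/M and wait on the edge until [m0]. *)
  have cB : cost c (B^~ u) (F^~ u) m0 l <= cost c (B^~ u) (F^~ u) m1 l + 1 + 2 * c +
      dgap c (F^~ u) l * m0%:R.
    have d0 := dgap_ge0 hB hF l.
    have [e10|lt10] := eqVneq m1 m0.
      have : 0 <= dgap c (F^~ u) l * m0%:R by rewrite mulr_ge0.
      by rewrite e10; move: c0; clear; lra.
    have [g [lg g0 gm Lg]] := cost_ex hB hF lm1.
    have lt10' : (m1 < m0)%N by rewrite ltn_neqAle; apply/andP; split.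
    have := cost_edge_extend hB hF lg g0 (or_introl gm) lt10'.
    by move: Lg; clear; lra.
  have cN : -1 <= cost c (B^~ u) (F^~ u) n 0.
    have [g [_ _ _ Lg]] := @cost_ex _ c (B^~ u) (F^~ u) hB hF n 0 (leq0n n).
    by have := walk_loss_ge0 hB hF 0 n g; move: Lg; clear; lra.
  have d0 := dgap_ge0 hB hF l.
  set dg := dgap c (F^~ u) l in d0 dE cA cZ cB.
  set lam := `|l|%N%:R in lam1 lamrho m1lo m1hi m0lo m0hi dl cZ.
  set X1 := cost _ _ _ m1 l in near1 cA cB; set X0 := cost _ _ _ m0 l in near0 cA cB.
  set Xz := cost _ _ _ n 0 in nearz cN cZ.
  have Jvn : (J * v)%:R * v%:R = n%:R :> R by rewrite -natrM -mulnA.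
  exact: (@shape_arith R c M A C1 D0 delta e eta L r theta dg lam m1%:R m0%:R n%:R (J * v)%:R v%:R w%:R
    X1 X0 Xz G1 Ga Gz).
(* The intercept is Lambda(0) = c, and [G0] is the common value of (c - Lambda(alpha)) / alpha. *)
exists c, (- G0) => alpha /andP[a0 aM].
have L0 : Lambda 0 = c.
  have am : 0 < M^-1 / 2 < M^-1 by lra.
  apply/eqP; rewrite eq_le; apply/andP; split; apply/ler_addgt0Pr => e e0.
    by have [_ h _ _] := main _ am e e0; lra.
  by have [h _ _ _] := main _ am e e0; lra.
have [->|an] := eqVneq alpha 0; first by rewrite L0 mulr0 addr0.
have ap : 0 < alpha by rewrite lt_def an.
have [->|aM'] := eqVneq alpha M^-1.
  by rewrite /G0; field; lra.
have am : 0 < alpha < M^-1 by rewrite ap lt_neqAle aM'.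
have e : (c - Lambda alpha) / alpha = G0.
  apply/eqP; rewrite eq_le; apply/andP; split; apply/ler_addgt0Pr => e e0.
    by have [_ _ h _] := main _ am e e0.
  by have [_ _ _ h] := main _ am e e0.
have : c - Lambda alpha = G0 * alpha by rewrite -e divfK// gt_eqF.
lra.
Qed.
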